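(* Let $X$ be an $n$-dimensional manifold with boundary $\partial X$. Then $\partial X$ is collared in $X$, that is, there is an embedding $f\colon \partial X\times[0,1)\to X$ onto an open subspace of $X$ such that $f(a,0)=a$ for all $a\in\partial X$.
   Context: Manifolds are topological manifolds (Hausdorff, second countable). An embedding is a homeomorphism onto its image. *)

(* Defs.v *)
From HB Require Import structures.
From mathcomp Require Import all_boot all_order all_algebra.
From mathcomp Require Import all_classical all_reals all_analysis.

Set Implicit Arguments.
Unset Strict Implicit.
Unset Printing Implicit Defensive.

Import Order.TTheory GRing.Theory Num.Theory.
Import numFieldNormedType.Exports.

Local Open Scope classical_set_scope.
Local Open Scope ring_scope.

(* Throughout, a set [A] of a topological space used as a type is the library's
   [set_type A], which carries the subspace topology. *)

Definition homeomorphism (S T : topologicalType) (f : S -> T) : Prop :=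
  continuous f /\ exists g : T -> S, [/\ continuous g, cancel f g & cancel g f].

Definition to_range (S T : topologicalType) (f : S -> T) (x : S) : range f :=
  exist _ (f x) (mem_set (imageT f x)).

Definition embedding (S T : topologicalType) (f : S -> T) : Prop :=
  homeomorphism (to_range f).

(* [half_space R n] is the set of x in R^n whose first coordinate is
   nonnegative. For n = 0 there is no coordinate: the half-space is the point
   R^0 and its bounding hyperplane is empty, so 0-manifolds have no boundary. *)
Definition half_space (R : realType) (n : nat) : set 'rV[R]_n :=
  [set x | forall i : 'I_n, i = 0%N :> nat -> 0 <= x ord0 i].

Arguments half_space : clear implicits.

Definition half_space_boundary (R : realType) (n : nat) : set 'rV[R]_n :=
  [set x | exists2 i : 'I_n, i = 0%N :> nat & x ord0 i = 0].
Arguments half_space_boundary : clear implicits.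

Definition chart (R : realType) (n : nat) (X : topologicalType) (U : set X)
    (phi : U -> half_space R n) : Prop :=
  [/\ open U, embedding phi & open (range phi)].

Definition manifold_with_boundary (R : realType) (n : nat)
    (X : topologicalType) : Prop :=
  [/\ hausdorff_space X, @second_countable X &
      forall x : X, exists2 U : set X, U x &
        exists phi : U -> half_space R n, chart phi].

Definition manifold_boundary (R : realType) (n : nat) (X : topologicalType) :
    set X :=
  [set x | exists (U : set X) (phi : U -> half_space R n) (u : U),
     [/\ chart phi, \val u = x & half_space_boundary R n (\val (phi u))]].

Arguments manifold_boundary : clear implicits.

Definition half_open_unit_interval (R : realType) : set R := `[0, 1[.
Arguments half_open_unit_interval : clear implicits.

Definition collared (R : realType) (X : topologicalType) (A : set X) : Prop :=
  exists f : A * half_open_unit_interval R -> X,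
    [/\ embedding f, open (range f) &
        forall (a : A) (t : half_open_unit_interval R),
          \val t = 0 -> f (a, t) = \val a].

(* Main.v *)
Require Import Defs.
From mathcomp Require Import all_boot all_order all_fingroup all_algebra.
From mathcomp Require Import all_classical all_reals all_analysis.
From mathcomp Require Import zify ring lra.

(** The proof has two halves.

    Invariance of the boundary.  A point which some chart sends to the bounding
    hyperplane cannot be sent to the interior by another chart
    ([boundary_point_not_interior]).  Indeed a half-ball can be pushed off its
    boundary point by a map that moves only points close to it.  Carried over
    to the other chart, such a push becomes a continuous map of the Euclidean
    space that is the identity outside a ball and misses the centre of that
    ball.  No such map exists ([surjective_of_id_outside_ball]), by a
    combinatorial degree argument: label the vertices of a fine cubical grid by
    the signs of the coordinates of the map.  The signed sum, over the
    simplices of the Freudenthal triangulation of a discrete torus, of the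
    determinants built from any labels vanishes, since expanding each
    determinant into its faces makes the faces cancel in pairs
    ([torus_det_sum0]).  Comparing with the labels of the identity leaves a
    simplex on which no coordinate has constant sign ([kuhn_cube]), and the
    image of a limit of such simplices is the centre.

    The collar.  Attach an external collar: let Z be the union of X x {0} and
    B x [0,oo) inside X x R, where B is the boundary of X.  By the first half a
    chart of X at a boundary point unfolds to an embedding of an open part of Z
    onto an open subset of the Euclidean space, (x,t) being sent to phi x
    lowered by t along the first axis.  Following Connelly, let lam be a
    function with small support in that chart: sliding points along the first
    axis gives a homeomorphism of Z that sends the outer point (b,t) to
    (b,t + lam b) and thus X x {0} to its union with the outer points of height
    at most lam ([fibre_shift_in_chart]).  Take a countable family of such
    functions lam_k on X, locally finite near B and with positive sum there
    ([bump_sequence], [locally_finite_bumps]).  If up_k lowers the outer points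
    by lam_k and u is the sum of all lam_k, then
      f (b,s) = up_0 (up_1 (... up_k (b, u(b) (1 - s))))   for large k
    is the collar ([collared_of_fibre_shifts]): near a given b only finitely
    many lam_k are nonzero, so that the maps up_k with k large fix the outer
    points above b and f is locally given by a single homeomorphism.  Local
    finiteness on B suffices, because the infinite composition is applied to
    outer points only. *)

Set Implicit Arguments.
Unset Strict Implicit.
Unset Printing Implicit Defensive.

Import Order.TTheory GRing.Theory Num.Theory.
Import numFieldNormedType.Exports.

Local Open Scope classical_set_scope.
Local Open Scope ring_scope.

(** * A combinatorial degree on the discrete torus *)

(** The grid points of the cube, with opposite faces adjacent, so that there is
    no boundary to keep track of when faces are cancelled. *)
Definition torus (n M : nat) := {ffun 'I_n.+1 -> 'I_M.+2}.

(** The simplex of the Freudenthal triangulation given by [q] and [s]: its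
    [j]-th vertex is reached from [q] after [j] unit steps, [s i] being the time
    at which coordinate [i] is incremented.  Indexing by times rather than by
    the order of the coordinates avoids inverses of permutations. *)
Definition chain_vertex (n M : nat) (q : torus n M) (s : 'S_n.+1) (j : nat) :
    torus n M :=
  [ffun i => q i + (s i < j)%N%:R].

(** The labels of the vertices of a simplex, one row per vertex, bordered by a
    column of ones: the determinant is the signed volume of the labels, and is
    nonzero only if no coordinate of the labels is constant on the simplex. *)
Definition label_simplex_mx (n M : nat) (L : torus n M -> 'I_n.+1 -> int)
    (q : torus n M) (s : 'S_n.+1) : 'M[int]_n.+2 :=
  \matrix_(j, k) (if unlift ord0 k is Some i then L (chain_vertex q s j) i
                  else 1).

Definition label_face_mx (n M : nat) (L : torus n M -> 'I_n.+1 -> int)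
    (q : torus n M) (s : 'S_n.+1) (j : nat) : 'M[int]_n.+1 :=
  \matrix_(a, i) L (chain_vertex q s (bump j a)) i.

(** Laplace expansion along the column of ones: the volume is the coboundary of
    the cochain that assigns to a face the determinant of its labels. *)
Lemma det_label_simplex (n M : nat) (L : torus n M -> 'I_n.+1 -> int) q s :
  \det (label_simplex_mx L q s) =
  \sum_(j < n.+2) (-1) ^+ j * \det (label_face_mx L q s j).
Proof.
rewrite (expand_det_col _ ord0); apply: eq_bigr => j _.
rewrite mxE unlift_none mul1r /cofactor addn0; congr (_ * \det _).
by apply/matrixP => a i; rewrite !mxE liftK.
Qed.

Definition signed_face_sum (n M : nat) (L : torus n M -> 'I_n.+1 -> int)
    (j : nat) : int :=
  \sum_(q : torus n M) \sum_(s : 'S_n.+1) (-1) ^+ s * \det (label_face_mx L q s j).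

(** Exchanging the steps [j - 1] and [j] changes only the vertex [j], hence keeps
    the face opposite to it, and changes the sign of the permutation. *)
Lemma inner_face_sum0 (n M : nat) (L : torus n M -> 'I_n.+1 -> int) (j : nat) :
  (0 < j <= n)%N -> signed_face_sum L j = 0.
Proof.
move=> /andP[j0 jn]; apply: big1 => q _.
have j1n : (j.-1 < n.+1)%N by lia.
have jn1 : (j < n.+1)%N by lia.
pose t := tperm (Ordinal j1n) (Ordinal jn1).
(* The swap is a fixed-point-free sign-reversing involution. *)
set S := \sum_s _; suff : S = - S by lia.
rewrite {1}/S (reindex_inj (mulIg t)) -sumrN; apply: eq_bigr => s _.
rewrite odd_permM odd_tperm /= -val_eqE /=.
have -> : (j.-1 != j) by lia.
rewrite addbT signrN mulNr; congr (- (_ * \det _)).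
apply/matrixP => a i; rewrite !mxE; congr (L _ i).
apply/ffunP => k; rewrite !ffunE permM; congr (_ + _%:R).
have aj : bump j a != j by rewrite eq_sym neq_bump.
congr nat_of_bool; move: aj; rewrite /t.
by case: tpermP => [->|->|] //=; lia.
Qed.

(** The face opposite to the first vertex of a simplex is the face opposite to
    the last vertex of the simplex that starts one step later and makes the
    omitted step at the end. *)
Lemma outer_face_sum (n M : nat) (L : torus n M -> 'I_n.+1 -> int) :
  signed_face_sum L 0 = (-1) ^+ n * signed_face_sum L n.+1.
Proof.
rewrite /signed_face_sum exchange_big [in RHS]exchange_big mulr_sumr /=.
pose c : 'S_n.+1 := lift_perm ord0 ord_max 1.
rewrite [RHS](reindex_inj (mulIg c)); apply: eq_bigr => s _.
(* The translation that performs the first step. *)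
pose d : torus n M := [ffun i => (s i == ord0)%:R].
rewrite [in RHS](reindex_inj (addIr d)) mulr_sumr; apply: eq_bigr => q _.
rewrite odd_permM odd_lift_perm odd_perm1 /= addbF signr_addb signr_odd.
rewrite mulrA mulrCA -expr2 sqrr_sign mulr1.
congr (_ * \det _); apply/matrixP => a i; rewrite !mxE; congr (L _ i).
apply/ffunP => k; rewrite !ffunE permM /= -addrA; congr (_ + _).
have -> : bump 0 a = a.+1 by [].
have -> : bump n.+1 a = a by rewrite /bump leqNgt ltn_ord.
case: (unliftP ord0 (s k)) => [l ->|->].
  by rewrite lift_perm_lift perm1 !lift0 lift_max ltnS add0r.
by rewrite lift_perm_id eqxx /= ltnNge -ltnS ltn_ord addr0.
Qed.

(** Stokes' theorem on a closed manifold. *)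
Lemma torus_det_sum0 (n M : nat) (L : torus n M -> 'I_n.+1 -> int) :
  \sum_(q : torus n M) \sum_(s : 'S_n.+1)
     (-1) ^+ s * \det (label_simplex_mx L q s) = 0.
Proof.
transitivity (\sum_(j < n.+2) (-1) ^+ j * signed_face_sum L j).
  under eq_bigr do under eq_bigr do rewrite det_label_simplex mulr_sumr.
  under eq_bigr do rewrite exchange_big /=.
  rewrite exchange_big /=; apply: eq_bigr => j _.
  rewrite mulr_sumr; apply: eq_bigr => q _.
  by rewrite mulr_sumr; apply: eq_bigr => s _; rewrite mulrCA.
rewrite big_ord_recl big_ord_recr /= big1 => [|j _]; last first.
  by rewrite inner_face_sum0 ?mulr0 //= /bump leq0n add1n /=.
rewrite outer_face_sum /bump leq0n add1n add0r mul1r -mulrDl exprS mulN1r.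
by rewrite subrr mul0r.
Qed.

(** The labels of the identity map, for a centre lying between the grid levels
    [m - 1] and [m]. *)
Definition threshold_label (n M m : nat) (v : torus n M) (i : 'I_n.+1) : int :=
  (m <= v i)%N%:R.

(** A column proportional to the column of ones can be cleared by a unimodular
    column operation. *)
Lemma det_label_simplex_const (n M : nat) (L : torus n M -> 'I_n.+1 -> int) q s
    (i : 'I_n.+1) (c : int) :
  (forall j : 'I_n.+2, L (chain_vertex q s j) i = c) ->
  \det (label_simplex_mx L q s) = 0.
Proof.
move=> Lc.
suff -> : \det (label_simplex_mx L q s) =
    \det (label_simplex_mx L q s *m
      (1%:M - c *: delta_mx ord0 (lift ord0 i))).
  rewrite (expand_det_col _ (lift ord0 i)) big1 // => j _.
  rewrite mulmxBr mulmx1 -scalemxAr !mxE liftK Lc.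
  rewrite (bigD1 ord0) //= big1 ?addr0 => [|k k0]; last first.
    by rewrite !mxE (negPf k0) mulr0.
  by rewrite !mxE unlift_none !eqxx /= !mulr1 subrr mul0r.
rewrite det_mulmx -[LHS]mulr1; congr (_ * _).
rewrite -det_tr det_trig.
  rewrite big1 // => j _; rewrite !mxE eqxx.
  have [->|j0] := eqVneq j ord0; last by rewrite mulr0 subr0.
  by rewrite andTb (negPf (neq_lift _ _)) mulr0 subr0.
apply/is_trig_mxP => j k jk; rewrite !mxE.
have -> : k == j = false by apply/negbTE; rewrite -val_eqE /=; lia.
have [k0|k0] := eqVneq k ord0; last by rewrite mulr0 subr0.
by move: jk; rewrite k0.
Qed.

Lemma val_chain_vertex (n M : nat) (q : torus n M) s j i :
  chain_vertex q s j i = ((q i + (s i < j)%N) %% M.+2)%N :> nat.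
Proof.
rewrite ffunE /=; congr (_ %% _)%N; congr (_ + _)%N.
by case: (s i < j)%N => //=; rewrite modn_small.
Qed.

Lemma val_chain_vertex_small (n M : nat) (q : torus n M) s j i :
  (q i < M.+1)%N -> chain_vertex q s j i = (q i + (s i < j)%N)%N :> nat.
Proof. by move=> qi; rewrite val_chain_vertex modn_small //; case: (s i < j)%N; lia. Qed.

Lemma chain_vertex_wrapped (n M : nat) (q : torus n M) s j i :
  q i = M.+1 :> nat ->
  chain_vertex q s j i = 0%N :> nat \/ chain_vertex q s j i = M.+1 :> nat.
Proof.
move=> qi; rewrite val_chain_vertex qi.
by case: (s i < j)%N; rewrite ?addn1 ?modnn ?addn0 ?modn_small; auto.
Qed.

(** Only the simplices of the cube that straddles the threshold in all
    coordinates count.  After the columns are permuted by [s], the vertex [j] has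
    the labels 1 exactly in the first [j] columns. *)
Lemma det_threshold_base (n M m : nat) (q : torus n M) s :
  (forall i, q i < M.+1)%N -> (forall i, (q i).+1 = m) ->
  \det (label_simplex_mx (threshold_label m) q s) = (-1) ^+ s.
Proof.
move=> qM qm.
pose T : 'M[int]_n.+2 := \matrix_(j, k) (k <= j)%N%:R.
have -> : label_simplex_mx (threshold_label m) q s =
          T *m (perm_mx (lift_perm ord0 ord0 s))^T.
  rewrite tr_perm_mx -col_permE; apply/matrixP => j k; rewrite !mxE.
  case: unliftP => [i ->|->]; last by rewrite lift_perm_id.
  rewrite lift_perm_lift /threshold_label val_chain_vertex_small // lift0.
  congr (_%:R); congr nat_of_bool; rewrite -(qm i).
  by case: (s i < j)%N; lia.
rewrite det_mulmx det_tr det_perm odd_lift_perm addbb addFb.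
rewrite det_trig; last first.
  by apply/is_trig_mxP => j k jk; rewrite mxE leqNgt jk.
by rewrite big1 ?mul1r // => i _; rewrite mxE leqnn.
Qed.

Lemma det_threshold0 (n M m : nat) (q : torus n M) s i :
  (q i < M.+1)%N -> (q i).+1 != m ->
  \det (label_simplex_mx (threshold_label m) q s) = 0.
Proof.
move=> qM qm; apply: (@det_label_simplex_const _ _ _ _ _ i (m <= q i)%N%:R).
move=> j; rewrite /threshold_label val_chain_vertex_small //.
by congr (_%:R); congr nat_of_bool; case: (s i < j)%N; lia.
Qed.

Lemma eq_det_label_simplex (n M : nat) (L L' : torus n M -> 'I_n.+1 -> int) q s :
  (forall (j : 'I_n.+2) i, L (chain_vertex q s j) i = L' (chain_vertex q s j) i) ->
  \det (label_simplex_mx L q s) = \det (label_simplex_mx L' q s).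
Proof.
move=> LL'; congr (\det _); apply/matrixP => j k; rewrite !mxE.
by case: unliftP => // i _.
Qed.

(** If no simplex had all coordinates nonconstant, then all determinants would
    vanish on the simplices that do not wrap around the torus, while those that
    wrap have the same determinants as for [threshold_label].  The difference of
    the two vanishing sums would then be the sum of [det_threshold_base] over
    all permutations, a factorial. *)
Lemma kuhn_cube (n M m : nat) (L : torus n M -> 'I_n.+1 -> bool) :
  (0 < m <= M.+1)%N ->
  (forall (v : torus n M) i k, v k = 0%N :> nat \/ v k = M.+1 :> nat ->
     L v i = (m <= v i)%N) ->
  exists q : torus n M, forall i, exists a b : torus n M,
    [/\ forall k, (q k <= a k <= (q k).+1)%N,
        forall k, (q k <= b k <= (q k).+1)%N, L a i & ~~ L b i].
Proof.
move=> /andP[m0 mM] Lbd; pose Li v i : int := (L v i)%:R.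
(* A simplex that wraps around has all its vertices on the boundary faces. *)
have wrap (q : torus n M) s k : q k = M.+1 :> nat ->
    \det (label_simplex_mx Li q s) = \det (label_simplex_mx (threshold_label m) q s).
  move=> qk; apply: eq_det_label_simplex => j i; congr (nat_of_bool _)%:R.
  exact/(Lbd _ _ k)/chain_vertex_wrapped.
have [q [s [qM det_neq0]]] : exists (q : torus n M) s,
    (forall i, (q i < M.+1)%N) /\ \det (label_simplex_mx Li q s) != 0.
  have [/existsP[q /andP[/forallP qM /existsP[s sP]]]|] := boolP [exists q : torus n M,
    [forall i, (q i < M.+1)%N] && [exists s, \det (label_simplex_mx Li q s) != 0]].
    by exists q, s.
  rewrite negb_exists => /forallP nodet.
  have := torus_det_sum0 Li.
  rewrite -[RHS](torus_det_sum0 (@threshold_label n M m)).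
  have m1M : (m.-1 < M.+2)%N by lia.
  (* The cube where all the coordinates of the threshold labels change. *)
pose q0 : torus n M := [ffun=> Ordinal m1M].
  have nodet0 (q : torus n M) s : (forall i, q i < M.+1)%N -> \det (label_simplex_mx Li q s) = 0.
    move=> qM; have := nodet q; rewrite negb_and negb_exists.
    by case/orP => [/forallP//|/forallP/(_ s)]; rewrite negbK => /eqP.
  have eq_off (q : torus n M) s : q != q0 ->
     \det (label_simplex_mx Li q s) = \det (label_simplex_mx (threshold_label m) q s).
    move=> qq0.
    have [/forallP qM|] := boolP [forall i, (q i < M.+1)%N]; last first.
      rewrite negb_forall => /existsP[k qk]; apply: (wrap _ _ k).
      by have := ltn_ord (q k); lia.
    have /existsP[i qi] : [exists i, q i != q0 i].
      rewrite -negb_forall; apply: contra qq0 => /forallP qq0.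
      by apply/eqP/ffunP => i; apply/eqP.
    rewrite nodet0 // (det_threshold0 _ (qM i)) //.
    by move: qi; rewrite ffunE -val_eqE /=; lia.
  have q0M i : (q0 i < M.+1)%N by rewrite ffunE /=; lia.
  have q0m i : (q0 i).+1 = m by rewrite ffunE /=; lia.
  rewrite (bigD1 q0) //= [RHS](bigD1 q0) //=.
  rewrite (eq_bigr _ (fun q qq0 => eq_bigr _ (fun s _ =>
    congr1 (fun x => (-1) ^+ nat_of_bool (odd_perm s) * x) (eq_off q s qq0)))).
  move=> /addIr; rewrite big1 => [/esym|s _]; last by rewrite nodet0 ?mulr0.
  under eq_bigr do rewrite (det_threshold_base _ q0M q0m) -expr2 sqrr_sign.
  by rewrite sumr_const card_Sn => /eqP; rewrite pnatr_eq0 gtn_eqF ?fact_gt0.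
have near (j : 'I_n.+2) k : (q k <= chain_vertex q s j k <= (q k).+1)%N.
  by rewrite val_chain_vertex_small //; case: (s k < j)%N; lia.
exists q => i.
have /existsP[a La] : [exists j : 'I_n.+2, L (chain_vertex q s j) i].
  rewrite -[X in is_true X]negbK; apply: contra det_neq0 => /existsPn nL.
  apply/eqP/(@det_label_simplex_const _ _ _ _ _ i 0) => j.
  by rewrite /Li (negPf (nL j)).
have /existsP[b Lb] : [exists j : 'I_n.+2, ~~ L (chain_vertex q s j) i].
  rewrite -[X in is_true X]negbK; apply: contra det_neq0 => /existsPn nL.
  apply/eqP/(@det_label_simplex_const _ _ _ _ _ i 1) => j.
  by rewrite /Li; have := nL j; rewrite negbK => ->.
by exists (chain_vertex q s a), (chain_vertex q s b); split.
Qed.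

(** * Maps of Euclidean space that are the identity outside a ball *)

Lemma rV_norm_leP (R : realType) (n : nat) (x : 'rV[R]_n) (e : R) : 0 <= e ->
  (`|x| <= e) <-> (forall i, `|x ord0 i| <= e).
Proof.
move=> e0; rewrite [`|x|]mx_normrE; split=> [xe i|xe].
  by apply: le_trans xe; apply: (le_bigmax _ _ (ord0, i)).
by apply/bigmax_leP; split=> // -[a i] _ /=; rewrite (ord1 a).
Qed.

Lemma rV_coord_norm_le (R : realType) (n : nat) (x : 'rV[R]_n) i :
  `|x ord0 i| <= `|x|.
Proof. by apply: (proj1 (rV_norm_leP x (normr_ge0 _))). Qed.

(** Otherwise, at a cluster point of simplices of smaller and smaller mesh given
    by [kuhn_cube] some coordinate of [Q y - c] is nonzero, so that it keeps a
    constant sign nearby, contrary to the choice of the simplices.  The norm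
    being the maximum norm, balls are cubes. *)
Lemma surjective_of_id_outside_ball (R : realType) (n : nat)
    (Q : 'rV[R]_n.+1 -> 'rV[R]_n.+1) (c : 'rV[R]_n.+1) (r : R) :
  0 < r -> continuous Q -> (forall y, r <= `|y - c| -> Q y = y) ->
  exists y, Q y = c.
Proof.
move=> r0 Qcont Qid; apply: contrapT => /forallNP noc.
(* The grid points of the cube of centre [c] and half-side [r]. *)
pose pt (M : nat) (v : torus n M) : 'rV[R]_n.+1 :=
  \row_i (c ord0 i + r * (2 * (v i)%:R / M.+1%:R - 1)).
have M0 (M : nat) : 0 < M.+1%:R :> R by rewrite ltr0n.
pose K := [set y : 'rV[R]_n.+1 | forall i, `[c ord0 i - r, c ord0 i + r]%classic (y ord0 i)].
have ptK M (v : torus n M) : K (pt M v).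
  move=> i; rewrite /= mxE in_itv /=.
  have v0 : 0 <= (v i)%:R / M.+1%:R :> R by rewrite divr_ge0.
  have v1 : (v i)%:R / M.+1%:R <= 1 :> R.
    by rewrite ler_pdivrMr // mul1r ler_nat -ltnS.
  rewrite -mulrA; move: v0 v1; set u := _ / _ => u0 u1.
  by apply/andP; split; nra.
have simplexP (M : nat) : exists p, K p /\ forall i, exists a b,
    [/\ `|p - a| <= 2 * r / M.+1%:R, `|p - b| <= 2 * r / M.+1%:R,
        c ord0 i < Q a ord0 i & Q b ord0 i <= c ord0 i].
  pose L (v : torus n M) i := c ord0 i < Q (pt M v) ord0 i.
  have near (q a : torus n M) : (forall k, (q k <= a k <= (q k).+1)%N) ->
      `|pt M q - pt M a| <= 2 * r / M.+1%:R.
    move=> qa; apply/rV_norm_leP => [|k].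
      by rewrite divr_ge0 ?mulr_ge0 ?ltW.
    rewrite !mxE; set u := (X in `|X| <= _).
    have -> : u = (2 * r / M.+1%:R) * ((q k)%:R - (a k)%:R) 
      by rewrite /u; move: (M0 M); set d := M.+1%:R => d0; field; rewrite lt0r_neq0.
    have w0 : 0 <= 2 * r / M.+1%:R by rewrite divr_ge0 ?mulr_ge0 ?ltW.
    rewrite normrM (ger0_norm w0).
    apply: ler_piMr => //.
    have /andP[] := qa k; rewrite -(ler_nat R) -[(a k <= _)%N](ler_nat R) -natr1.
    by move=> ? ?; rewrite ler_norml; lra.
  have [||q qP] := @kuhn_cube n M (M.+1)./2.+1 L.
  - by lia.
  - move=> v i k vk; rewrite /L Qid; last first.
      apply: le_trans (rV_coord_norm_le _ k); rewrite !mxE.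
      case: vk => ->; rewrite ler_normr; apply/orP.
        by right; rewrite mulr0 mul0r; lra.
      by left; rewrite -mulrA divff ?lt0r_neq0//; lra.
    rewrite mxE ltrDl pmulr_rgt0 // subr_gt0 ltr_pdivlMr // mul1r -natrM ltr_nat.
    by rewrite ltn_half_double mul2n.
  exists (pt M q); split=> // i; have [a [b [qa qb La Lb]]] := qP i.
  by exists (pt M a), (pt M b); split; [exact: near|exact: near| | rewrite leNgt].
have [p pP] := choice simplexP.
have Kc : compact K.
  apply: (@rV_compact _ _ (fun i => `[c ord0 i - r, c ord0 i + r]%classic)) => i.
  exact: segment_compact.
have [|x [_ xcl]] := Kc (p @ \oo) _ ; first by exists 0%N => // M _; by case: (pP M).
have [i xi] : exists i, Q x ord0 i != c ord0 i.
  apply: contrapT => /forallNP xi; apply: (noc x); apply/rowP => i.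
  by apply/eqP/contraT => /xi.
have Qi : {for x, continuous (fun y => Q y ord0 i)}.
  apply: (@continuous_comp _ _ _ Q (fun v : 'rV_n.+1 => v ord0 i)) . exact: Qcont.
  exact: coord_continuous.
have [e e0 xe] : exists2 e, 0 < e & forall y, `|x - y| < e ->
    (0 < Q x ord0 i - c ord0 i) = (0 < Q y ord0 i - c ord0 i) /\
    Q y ord0 i != c ord0 i.
  pose d := `|Q x ord0 i - c ord0 i|.
  have d0 : 0 < d by rewrite normr_gt0 subr_eq0.
  have /cvgr_dist_lt /(_ d d0) := Qi.
  case/nbhs_ballP => e /= e0 eP; exists e => // y xy.
  have := eP y; rewrite /= -ball_normE /= => /(_ xy).
  rewrite /d; move: xi; rewrite neq_lt => /orP[] h.
    rewrite [X in _ < X]ltr0_norm ?subr_lt0// ltr_norml => /andP[h1 h2].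
    split; last by rewrite lt_eqF //; lra.
    by rewrite !ltNge; congr (~~ _); apply/idP/idP; lra.
  rewrite [X in _ < X]gtr0_norm ?subr_gt0// ltr_norml => /andP[h1 h2].
  split; last by rewrite gt_eqF //; lra.
  by apply/idP/idP; lra.
have e2 : 0 < e / 2 by lra.
have [N _ NP] : \forall M \near \oo, 2 * r / M.+1%:R < e / 2.
  near=> M; rewrite ltr_pdivrMr //.
  suff h : 4 * r / e < M.+1%:R by rewrite ltr_pdivrMr // in h; lra.
  by apply: (@lt_trans _ _ M%:R); rewrite ?ltr_nat//; near: M; exact: nbhs_infty_gtr.
have [_ [[M NM <-]]] : ([set p M | M in [set M | (N <= M)%N]] `&` ball x (e / 2)) !=set0.
  apply: xcl; last exact: nbhsx_ballx.
  by exists N => // M NM; exists M.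
rewrite -ball_normE /= => xM.
have [a [b [qa qb La Lb]]] := (pP M).2 i.
have close y : `|p M - y| <= 2 * r / M.+1%:R -> `|x - y| < e.
  move=> py; apply: (le_lt_trans (ler_distD (p M) x y)).
  by rewrite [e]splitr; apply: ltrD => //; exact: le_lt_trans (NP M NM).
have [h _] := xe _ (close _ qa); have [h' neq] := xe _ (close _ qb).
by move: La Lb; rewrite -subr_gt0 -h h' subr_gt0 leNgt => ->.
Unshelve. all: end_near. Qed.

(** * Charts of the half-space and invariance of the boundary *)

(** Local homeomorphisms are easier to compose as total functions: an arbitrary
    value is taken outside the open set. *)
Lemma open_extension (X Y : topologicalType) (U : set X) (f : U -> Y) (y0 : Y) :
  open U -> continuous f ->
  exists F : X -> Y, (forall v, F (\val v) = f v) /\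
    forall x, U x -> {for x, continuous F}.
Proof.
move=> Uo fc; pose F x := if insub x is Some v then f v else y0.
have FE v : F (\val v) = f v by rewrite /F valK.
exists F; split=> // x Ux B.
have -> : x = \val (exist _ x (mem_set Ux) : U) by [].
rewrite FE => /(fc _)/= [A [[W Wo <-] /= Ox WB]].
rewrite /nbhs /=; apply: (@filterS _ _ _ (W `&` U)).
  move=> z [Wz Uz] /=; rewrite -[z]/(\val (exist _ z (mem_set Uz) : U)) FE.
  exact: WB.
by apply: open_nbhs_nbhs; split; [exact: openI|].
Qed.

Lemma continuous_near_eq (X Y : topologicalType) (f h : X -> Y) x :
  nbhs x [set z | f z = h z] -> {for x, continuous h} -> {for x, continuous f}.
Proof.
move=> fh hc A; rewrite (nbhs_singleton fh) => /hc hA.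
by apply: filterS2 fh hA => z /= -> .
Qed.

Section RealContinuity.
Variables (R : realType) (T : topologicalType) (f g : T -> R) (x : T).
Hypotheses (fc : {for x, continuous f}) (gc : {for x, continuous g}).

Lemma maxr_continuous : {for x, continuous (fun x => Num.max (f x) (g x))}.
Proof. exact: (@continuous_max R T f g x fc gc). Qed.

Lemma minr_continuous : {for x, continuous (fun x => Num.min (f x) (g x))}.
Proof. exact: (@continuous_min R T f g x fc gc). Qed.

Lemma cstr_continuous (c : R) : {for x, continuous (fun=> c)}.
Proof. exact: cst_continuous. Qed.

Lemma oppr_continuous : {for x, continuous (fun x => - f x)}.
Proof. exact: cvgN fc. Qed.

Lemma addr_continuous : {for x, continuous (fun x => f x + g x)}.
Proof. exact: cvgD fc gc. Qed.

Lemma subr_continuous : {for x, continuous (fun x => f x - g x)}.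
Proof. exact: cvgB fc gc. Qed.

Lemma mulr_continuous : {for x, continuous (fun x => f x * g x)}.
Proof. exact: cvgM fc gc. Qed.

Lemma invr_continuous : f x != 0 -> {for x, continuous (fun x => (f x)^-1)}.
Proof. by move=> fx0; exact: cvgV fx0 fc. Qed.

End RealContinuity.

Section HalfSpaceCharts.
Variables (R : realType) (n : nat).
Local Notation V := 'rV[R]_n.+1.

Definition shift1 (y : V) (t : R) : V := y + t *: delta_mx ord0 ord0.

(** The projection of the space onto the half-space along the first axis. *)
Definition retract (y : V) : V := shift1 y (Num.max 0 (- y ord0 ord0)).

Lemma shift1E y t i : shift1 y t ord0 i = y ord0 i + (if i == ord0 then t else 0).
Proof. by rewrite !mxE eqxx /=; case: (i == ord0); rewrite ?mulr1 ?mulr0. Qed.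

Lemma shift1_0 y : shift1 y 0 = y.
Proof. by rewrite /shift1 scale0r addr0. Qed.

Lemma shift1D y s t : shift1 (shift1 y s) t = shift1 y (s + t).
Proof. by rewrite /shift1 scalerDl addrA. Qed.

Lemma retractE y : retract y ord0 ord0 = Num.max (y ord0 ord0) 0.
Proof.
rewrite shift1E eqxx; have [y0|y0] := leP (y ord0 ord0) 0.
  by rewrite max_r ?subrr // oppr_ge0.
by rewrite max_l ?addr0 // oppr_le0 ltW.
Qed.

Lemma retract_ge0 y : 0 <= retract y ord0 ord0.
Proof. by rewrite retractE le_max lexx orbT. Qed.

Lemma retract_id (y : V) : 0 <= y ord0 ord0 -> retract y = y.
Proof. by move=> y0; rewrite /retract max_l ?shift1_0 // oppr_le0. Qed.

Lemma shift1_continuous (T : topologicalType) (f : T -> V) (a : T -> R) x :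
  {for x, continuous f} -> {for x, continuous a} ->
  {for x, continuous (fun x => shift1 (f x) (a x))}.
Proof.
move=> fc ac; apply: (cvgD fc); apply: (cvgZ ac); exact: cvg_cst.
Qed.

Lemma dist_continuous (T : topologicalType) (f : T -> V) (c : V) x :
  {for x, continuous f} -> {for x, continuous (fun x => `|f x - c|)}.
Proof. by move=> fc; apply: cvg_norm; apply: (cvgB fc); exact: cvg_cst. Qed.


Lemma coord0_continuous : continuous (fun y : V => y ord0 ord0).
Proof. exact: coord_continuous. Qed.

Lemma retract_continuous : continuous retract.
Proof.
move=> y; apply: (@shift1_continuous _ id).
  exact: cvg_id.
apply: maxr_continuous; first exact: cstr_continuous.
by apply: oppr_continuous; exact: coord0_continuous.
Qed.

Lemma half_spaceE (z : V) : half_space R n.+1 z <-> 0 <= z ord0 ord0.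
Proof.
split=> [|z0 i i0]; first exact.
by rewrite (_ : i = ord0) //; apply: val_inj.
Qed.

Lemma half_space_boundaryE (z : V) :
  half_space_boundary R n.+1 z <-> z ord0 ord0 = 0.
Proof.
split=> [[i i0]|z0]; last by exists ord0.
by rewrite (_ : i = ord0) //; apply: val_inj.
Qed.

(** A chart whose image is the part of the half-space in a ball around [c], with
    its inverse precomposed by [retract].  The inverse is then continuous at
    points of the Euclidean space, with no reference to the subspace topology of
    the half-space, and it is constant below the hyperplane along the first axis,
    which is what the external collar requires. *)
Definition half_chart (X : topologicalType) (U : set X) (phi : X -> V)
    (g : V -> X) (c : V) (r : R) : Prop :=
  [/\ open U, forall x, U x -> {for x, continuous phi},
      forall x, U x -> [/\ 0 <= phi x ord0 ord0, `|phi x - c| < r & g (phi x) = x],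
      forall y, `|retract y - c| < r -> U (g y) /\ phi (g y) = retract y
    & forall y, `|retract y - c| < r -> {for y, continuous g}].

(** Any chart can be cut down to a small ball around the image of a given point;
    the last clause records that it is still a restriction of the same chart. *)
Lemma half_chart_of_chart (X : topologicalType) (U : set X)
    (phi : U -> half_space R n.+1) (u : U) (r0 : R) : chart phi -> 0 < r0 ->
  exists U' phi' g r,
    [/\ half_chart U' phi' g (\val (phi u)) r, 0 < r, r <= r0, U' (\val u) &
        forall x, U' x -> exists2 v : U, \val v = x & phi' x = \val (phi v)].
Proof.
case=> Uo [phic [gi [gic phiK giK]]] [W Wo WE] r00.
have valc (T : topologicalType) (A : set T) : continuous (\val : A -> T).
  exact: initial_continuous.
have phic' : continuous (\val \o phi).
  move=> v; apply: continuous_comp; last exact: valc.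
  by move=> B /(continuous_comp (phic v) (valc _ _ _)).
have [F [FE Fc]] := open_extension (\val (phi u)) Uo phic'.
have Wu : W (\val (phi u)).
  have : range phi (phi u) by exists u.
  by rewrite -WE.
have [r [r_gt0 rr0 rW]] : exists r, [/\ 0 < r, r <= r0 &
    forall z, `|z - \val (phi u)| < r -> W z].
  have /nbhs_ballP[r /= r_gt0 rW] : nbhs (\val (phi u)) W by exact: open_nbhs_nbhs.
  exists (Num.min r r0); split; rewrite ?lt_min ?r_gt0 ?ge_min ?lexx ?orbT//.
  move=> z; rewrite lt_min => /andP[zr _]; apply: rW.
  by rewrite -ball_normE /= distrC.
pose B := [set y | `|retract y - \val (phi u)| < r].
have Bo : open B.
  apply: (@open_comp _ _ (fun y => `|retract y - \val (phi u)|) [set t | t < r]).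
    by move=> y _; apply: dist_continuous; exact: retract_continuous.
  exact: open_lt.
pose toH (y : V) : half_space R n.+1 :=
  exist _ (retract y) (mem_set ((half_spaceE _).2 (retract_ge0 y))).
have toHc : continuous toH.
  by apply: continuous_comp_initial; exact: retract_continuous.
have toHr (y : B) : range phi (toH (\val y)).
  by rewrite -WE; apply: rW; have := set_mem (valP y).
pose toR (y : B) : range phi := exist _ (toH (\val y)) (mem_set (toHr y)).
have toRc : continuous toR.
  apply: continuous_comp_initial => y.
  apply: (@continuous_comp _ _ _ (\val : B -> V) toH); last exact: toHc.
  exact: (valc _ B).
have gc : continuous (\val \o gi \o toR).
  move=> y; apply: continuous_comp; first exact: toRc.
  by apply: continuous_comp; [exact: gic|exact: valc].
have [g [gE g_c]] := open_extension (\val u) Bo gc.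
have phigi (w : range phi) : phi (gi w) = \val w.
  by have := congr1 val (giK w).
exists ([set x | exists2 v : U, \val v = x & `|F x - \val (phi u)| < r]), F, g, r.
have gP y : `|retract y - \val (phi u)| < r ->
    exists2 v : U, g y = \val v & \val (phi v) = retract y.
  move=> yB; pose b : B := exist _ y (mem_set yB).
  exists (gi (toR b)); first by rewrite -[y]/(\val b) gE.
  by rewrite phigi.
split=> //; last 1 first.
- by move=> x [v vx _]; exists v => //; rewrite -vx FE.
- split.
  + have -> : [set x | exists2 v : U, \val v = x & `|F x - \val (phi u)| < r] =
        U `&` (fun x => `|F x - \val (phi u)|) @^-1` [set t | t < r].
      apply/seteqP; split=> [x [v <- vr]|x [Ux xr]]; first by split=> //; exact: set_mem (valP v).
      by exists (exist _ x (mem_set Ux)).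
    rewrite openE => x [Ux xr]; apply: filterI; first exact: open_nbhs_nbhs.
    apply: (dist_continuous (Fc x Ux) (t := [set t | t < r])).
    by apply: (@open_nbhs_nbhs _ _ [set t | t < r]); split=> //; exact: open_lt.
  + by move=> x [v <- _]; apply: Fc; exact: set_mem (valP v).
  + move=> x [v <-]; rewrite FE => vr.
    have v0 : 0 <= \val (phi v) ord0 ord0 by apply/half_spaceE; exact: set_mem (valP (phi v)).
    split=> //.
    have [w gw phiw] : exists2 w : U,
        g (\val (phi v)) = \val w & \val (phi w) = retract (\val (phi v)).
      by apply: gP; rewrite retract_id.
    rewrite gw; congr val; apply: (can_inj phiK); apply: val_inj => /=.
    by apply: val_inj; rewrite phiw retract_id.
  + move=> y yr; have [v gv phiv] := gP y yr.
    by rewrite gv FE /= phiv; split=> //; exists v => //; rewrite FE /= phiv.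
  + by move=> y yr; apply: g_c.
- by exists u => //; rewrite FE subrr normr0.
Qed.

Lemma compact_half_ball (c : V) (e : R) :
  compact [set z : V | 0 <= z ord0 ord0 /\ `|z - c| <= e].
Proof.
apply: bounded_closed_compact; last first.
  have -> : [set z : V | 0 <= z ord0 ord0 /\ `|z - c| <= e] =
      (fun z : V => z ord0 ord0) @^-1` [set t | 0 <= t] `&`
      (fun z : V => `|z - c|) @^-1` [set t | t <= e] by [].
  apply: closedI; apply: closed_comp.
  - by move=> z _; exact: coord0_continuous.
  - exact: closed_ge.
  - by move=> z _; apply: dist_continuous; exact: cvg_id.
  - exact: closed_le.
exists (`|c| + e); split; first exact: num_real.
move=> M cM z [_ ze]; apply: le_trans (ltW cM).
by rewrite -[z](subrK c) (le_trans (ler_normD _ _)) // addrC lerD2l.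
Qed.

(** Invariance of the boundary: the point [x] cannot lie on the hyperplane for
    one chart and, for another one, at the centre of a ball that does not
    cross the hyperplane.  The map [Q] below is the push off [c = phi x], seen
    in the second chart: it is the identity outside a ball around [phi' x] and
    misses [phi' x]. *)
Lemma boundary_point_not_interior (X : topologicalType) (U U' : set X)
    (phi phi' : X -> V) (g g' : V -> X) (r r' : R) (x : X) :
  half_chart U phi g (phi x) r -> half_chart U' phi' g' (phi' x) r' ->
  U x -> U' x -> 0 < r -> 0 < r' -> phi x ord0 ord0 = 0 ->
  r' <= phi' x ord0 ord0 -> False.
Proof.
move=> [Uo phic phiU gU gc] [U'o phi'c phi'U g'U g'c] Ux U'x r0 r'0 x0 x'0.
have [_ _ gx] := phiU _ Ux; have [_ _ g'x] := phi'U _ U'x.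
pose c := phi x; pose c' := phi' x.
have ret' y : `|y - c'| < r' -> retract y = y.
  move=> yc; apply: retract_id.
  have := le_lt_trans (rV_coord_norm_le (y - c') ord0) yc.
  rewrite !mxE ltr_norml => /andP[h _]; rewrite -/c' in x'0.
  lra.
have retc : retract c = c by rewrite retract_id // /c x0.
have [d [d0 dr dP]] : exists d, [/\ 0 < d, d < r &
    forall z, `|z - c| <= d -> U' (g z) /\ `|phi' (g z) - c'| < r' / 2].
  have gcc : {for c, continuous g} by apply: gc; rewrite retc subrr normr0.
  have gcx : g c = x by [].
  have : nbhs c [set z | U' (g z) /\ `|phi' (g z) - c'| < r' / 2].
    apply: filterI.
      by apply: gcc; rewrite gcx; exact: open_nbhs_nbhs.
    have cc : {for c, continuous (fun z => `|phi' (g z) - c'|)}.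
      apply: dist_continuous; apply: (@continuous_comp _ _ _ g phi') => //.
      by rewrite gcx; exact: phi'c.
    apply: (cc [set t | t < r' / 2]).
    apply: (@open_nbhs_nbhs _ _ [set t | t < r' / 2]); split; first exact: open_lt.
    by rewrite /= gcx subrr normr0 divr_gt0.
  case/nbhs_ballP => e /= e0 eP; exists (Num.min (e / 2) (r / 2)).
  rewrite lt_min !divr_gt0 // gt_min; split=> //.
    by apply/orP; right; lra.
  move=> z; rewrite le_min => /andP[ze _]; apply: eP.
  by rewrite -ball_normE /= distrC; lra.
(* Every point of the half-space that is close to [c] is raised, and [c] most:
   a point could only be sent to [c] from below the hyperplane. *)
pose push (z : V) := shift1 z (Num.max 0 (d / 2 - `|z - c|)).
have pushc : continuous push.
  move=> z; apply: (@shift1_continuous _ id); first exact: cvg_id.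
  apply: maxr_continuous; first exact: cstr_continuous.
  apply: subr_continuous; first exact: cstr_continuous.
  by apply: dist_continuous; exact: cvg_id.
have push_ge (z : V) : 0 <= z ord0 ord0 -> 0 <= push z ord0 ord0.
  by move=> z0; rewrite shift1E eqxx addr_ge0 // le_max lexx.
have push_id (z : V) : d / 2 <= `|z - c| -> push z = z.
  by move=> zd; rewrite /push max_l ?shift1_0 // subr_le0.
have push_neq (z : V) : 0 <= z ord0 ord0 -> push z <> c.
  move=> z0 pz; have [zd|zd] := leP (d / 2) `|z - c|.
    by have pzz := push_id _ zd; move: zd; rewrite -pzz pz subrr normr0; lra.
  have := congr1 (fun y : V => y ord0 ord0) pz.
  rewrite shift1E eqxx max_r ?subr_ge0 ?ltW// x0; lra.
have push_dist (z : V) : `|push z - c| <= Num.max (`|z - c|) (d / 2).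
  have [zd|zd] := leP (d / 2) `|z - c|; first by rewrite push_id.
  have w0 : 0 <= d / 2 - `|z - c| by rewrite subr_ge0 ltW.
  rewrite /push max_r // /shift1 addrAC.
  apply: (le_trans (ler_normD _ _)); rewrite normrZ ger0_norm //.
  rewrite -lerBrDl; apply: ler_piMr => //.
  apply/rV_norm_leP => // i; rewrite mxE; case: (_ && _); rewrite ?normr1 ?normr0 //.
pose O := [set y | `|y - c'| < r' /\ U (g' y)].
have O_U' y : O y -> [/\ U' (g' y), phi' (g' y) = y & {for y, continuous g'}].
  move=> [yr _]; have ry := ret' y yr.
  have yr' : `|retract y - c'| < r' by rewrite ry.
  by have [] := g'U _ yr'; rewrite ry => ? ?; split=> //; exact: g'c.
have Oo : open O.
  rewrite openE => y Oy; have [yr Uy] := Oy; have [_ _ g'cy] := O_U' y Oy.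
  apply: filterI; last by apply: g'cy; exact: open_nbhs_nbhs.
  have cc : {for y, continuous (fun z : V => `|z - c'|)} by apply: dist_continuous; exact: cvg_id.
  apply: (cc [set t | t < r']).
  by apply: (@open_nbhs_nbhs _ _ [set t | t < r']); split=> //; exact: open_lt.
pose A := [set z : V | 0 <= z ord0 ord0 /\ `|z - c| <= d / 2].
have AP z : A z -> [/\ `|retract z - c| < r, retract z = z & `|z - c| <= d].
  by move=> [z0 zd]; rewrite retract_id //; split=> //; lra.
(* Outside the compact set [K] nothing moves. *)
pose K := (fun z => phi' (g z)) @` A.
have Kclosed : closed K.
  apply: compact_closed; first exact: norm_hausdorff.
  apply: continuous_compact.
    apply: continuous_in_subspaceT => z /set_mem Az; have [zr rz zd] := AP z Az.
    apply: (@continuous_comp _ _ _ g phi'); first exact: gc.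
    by apply: phi'c; case: (dP z zd).
  exact: compact_half_ball.
have KO y : K y -> O y /\ `|y - c'| < r' / 2.
  move=> [z Az <-]; have [zr rz zd] := AP z Az; have [U'gz near] := dP z zd.
  have [Ugz _] := gU z zr; have [_ _ gg] := phi'U _ U'gz.
  by split=> //; split; [rewrite -/c'; lra|rewrite gg].
pose F y := phi' (g (push (phi (g' y)))).
pose Q y := if pselect (O y) then F y else y.
have Q_off y : ~ K y -> Q y = y.
  move=> nK; rewrite /Q; case: pselect => // Oy.
  have [U'y phiy _] := O_U' y Oy; have [_ Uy] := Oy.
  have [z0 _ gz] := phiU _ Uy; rewrite /F.
  have [zd|zd] := leP (d / 2) `|phi (g' y) - c|; first by rewrite push_id // gz.
  by case: nK; exists (phi (g' y)); [split=> //; exact: ltW|rewrite gz].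
have Oprop y : O y -> let z := phi (g' y) in
    [/\ 0 <= push z ord0 ord0, `|retract (push z) - c| < r & U' (g (push z))].
  move=> Oy z; have [U'y phiy _] := O_U' y Oy; have [_ Uy] := Oy.
  have [z0 zr gz] := phiU _ Uy; have pz0 := push_ge _ z0; split=> //.
    rewrite retract_id //; apply: le_lt_trans (push_dist _) _.
    by rewrite gt_max zr; lra.
  have [zd|zd] := leP (d / 2) `|phi (g' y) - c|; first by rewrite /z push_id // gz.
  have [|//] := dP (push z); apply: le_trans (push_dist _) _.
  by rewrite ge_max; apply/andP; split; rewrite /z; lra.
have Qc : continuous Q.
  move=> y; have [Oy|nO] := pselect (O y).
    have QF : nbhs y [set w | Q w = F w].
      apply: filterS (open_nbhs_nbhs (conj Oo Oy)) => w Ow /=.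
      by rewrite /Q; case: pselect.
    apply: continuous_near_eq QF _.
    have [_ Uy] := Oy; have [_ _ g'cy] := O_U' y Oy.
    have [_ pr U'p] := Oprop y Oy.
    apply: (@continuous_comp _ _ _ g' (fun w => phi' (g (push (phi w))))) => //.
    apply: (@continuous_comp _ _ _ phi (fun w => phi' (g (push w)))); first exact: phic.
    apply: (@continuous_comp _ _ _ push (fun w => phi' (g w))); first exact: pushc.
    by apply: (@continuous_comp _ _ _ g phi'); [exact: gc|exact: phi'c].
  have nK : ~ K y by move=> /KO[].
  have Qid : nbhs y [set w | Q w = id w].
    by apply: filterS (open_nbhs_nbhs (conj (closed_openC Kclosed) nK)) => w; exact: Q_off.
  by apply: continuous_near_eq Qid _; exact: cvg_id.
have [|y Qy] := surjective_of_id_outside_ball r'0 Qc (c := c').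
  by move=> y yr; apply: Q_off => /KO[[]]; rewrite ltNge yr.
move: Qy; rewrite /Q; case: pselect => [Oy|nO] /= => [Fy|yc']; last first.
  by apply: nO; rewrite yc'; split; rewrite ?subrr ?normr0 // g'x.
have [p0 pr U'p] := Oprop y Oy; have [_ Uy] := Oy.
have gp : g (push (phi (g' y))) = x.
  by have [_ _ <-] := phi'U _ U'p; rewrite -/(F y) Fy g'x.
have [z0 _ _] := phiU _ Uy; apply: (push_neq _ z0).
by have [_] := gU _ pr; rewrite gp retract_id.
Qed.

(** On the domain of a chart, being a boundary point in the sense of some
    chart amounts to lying on the hyperplane for this one. *)
Lemma boundary_half_chart (X : topologicalType) (x : X) :
  manifold_boundary R n.+1 X x ->
  exists U phi g r, [/\ half_chart U phi g (phi x) r, 0 < r, U x,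
    phi x ord0 ord0 = 0 &
    forall y, U y -> (manifold_boundary R n.+1 X y <-> phi y ord0 ord0 = 0)].
Proof.
case=> [W [psi [w [psich <- psiw0]]]].
have [U [phi [g [r [phich r0 _ Uw phiE]]]]] := half_chart_of_chart w psich ltr01.
have phiw : phi (\val w) = \val (psi w).
  by have [v vw ->] := phiE _ Uw; congr (\val (psi _)); apply: val_inj.
rewrite -phiw in phich psiw0; move/half_space_boundaryE in psiw0.
exists U, phi, g, r; split=> // y Uy; split=> [|phiy0]; last first.
  have [v vy phiv] := phiE _ Uy; exists W, psi, v; split=> //.
  by apply/half_space_boundaryE; rewrite -phiv.
case=> [W' [psi' [w' [psi'ch w'y psi'w0]]]].
apply: contrapT => phiy0; have [v vy phiv] := phiE _ Uy.
have phiy_gt0 : 0 < phi y ord0 ord0.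
  have [_ _ phiU _ _] := phich; have [phiy_ge0 _ _] := phiU _ Uy.
  by rewrite lt_neqAle phiy_ge0 andbT eq_sym; apply/eqP.
have [U1 [phi1 [g1 [r1 [ch1 r10 _ U1w' phi1E]]]]] := half_chart_of_chart w' psi'ch ltr01.
have phi1y : phi1 y = \val (psi' w').
  rewrite -w'y; have [v1 v1w ->] := phi1E _ U1w'.
  by congr (\val (psi' _)); apply: val_inj.
have [U2 [phi2 [g2 [r2 [ch2 r20 r2le U2v phi2E]]]]] := half_chart_of_chart v psich phiy_gt0.
have phi2y : phi2 y = phi y.
  rewrite phiv -vy; have [v2 v2v ->] := phi2E _ U2v.
  by congr (\val (psi _)); apply: val_inj.
rewrite w'y in U1w'; rewrite vy in U2v.
apply: (@boundary_point_not_interior X U1 U2 phi1 phi2 g1 g2 r1 r2 y) => //.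
- by rewrite phi1y.
- by rewrite phi2y phiv.
- by rewrite phi1y; exact/half_space_boundaryE.
- by rewrite phi2y.
Qed.

End HalfSpaceCharts.

(** * External collars and stretching of intervals *)

Section OuterCollar.
Variables (R : realType) (X : topologicalType) (B : set X).

Definition outer_collar : set (X * R) := [set p | p.2 = 0 \/ B p.1 /\ 0 <= p.2].

(** The maps [up] and [down] push the external collar into, respectively out of,
    the space: [up] lowers the outer points by [lam], and those of height at most
    [lam] land in [X]. *)
Definition fibre_shift (lam : X -> R) (up down : outer_collar -> outer_collar) :=
  [/\ continuous up, continuous down, cancel up down, cancel down up &
   [/\ forall z, B (\val z).1 -> lam (\val z).1 <= (\val z).2 ->
      \val (up z) = ((\val z).1, (\val z).2 - lam (\val z).1) &
    forall z, (\val z).2 = 0 \/ (\val z).2 <= lam (\val z).1 ->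
      (\val (up z)).2 = 0]].

(** A function that can serve to build partitions: anything continuous with
    smaller support is the amount of a fibre shift.  Formulated in this way, charts
    no longer occur in the later arguments. *)
Definition bump (mu : X -> R) := [/\ continuous mu, forall x, 0 <= mu x <= 1 &
  forall lam : X -> R, continuous lam -> (forall x, 0 <= lam x) ->
   (forall x, lam x != 0 -> mu x != 0) ->
   exists up down, fibre_shift lam up down].
End OuterCollar.

Section Stretch.
Variables (R : realType) (a : R).

(** The increasing map that lowers the negative half-line by [l], is the identity
    from [a] on, and is affine in between; [unstretch] is its inverse. *)
Definition stretch (l t : R) := t - l * Num.min 1 (Num.max 0 ((a - t) / a)).
Definition unstretch (l t : R) := t + l * Num.min 1 (Num.max 0 ((a - t) / (a + l))).

Lemma clamp_le0 (x : R) : x <= 0 -> Num.min 1 (Num.max 0 x) = 0.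
Proof. by move=> x0; rewrite max_l // min_r. Qed.
Lemma clamp_ge1 (x : R) : 1 <= x -> Num.min 1 (Num.max 0 x) = 1.
Proof. by move=> x1; rewrite max_r ?min_l //; lra. Qed.
Lemma clamp01 (x : R) : 0 <= x -> x <= 1 -> Num.min 1 (Num.max 0 x) = x.
Proof. by move=> x0 x1; rewrite max_r // min_r. Qed.

Lemma stretch_le0 (l t : R) : 0 < a -> t <= 0 -> stretch l t = t - l.
Proof. by move=> a0 t0; rewrite /stretch clamp_ge1 ?mulr1 // ler_pdivlMr //; lra. Qed.
Lemma stretch_mid (l t : R) : 0 < a -> 0 <= t -> t <= a -> stretch l t = t - l * ((a - t) / a).
Proof.
by move=> a0 t0 ta; rewrite /stretch clamp01 // ?ler_pdivrMr ?divr_ge0 ?subr_ge0 //; lra.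
Qed.
Lemma stretch_ge (l t : R) : 0 < a -> a <= t -> stretch l t = t.
Proof.
move=> a0 ta; rewrite /stretch clamp_le0 ?mulr0 ?subr0 // pmulr_lle0 ?invr_gt0 //; lra.
Qed.

Lemma unstretch_le (l t : R) : 0 < a -> 0 <= l -> t <= - l -> unstretch l t = t + l.
Proof.
move=> a0 l0 t0; have al : 0 < a + l by lra.
by rewrite /unstretch clamp_ge1 ?mulr1 // ler_pdivlMr //; lra.
Qed.
Lemma unstretch_mid (l t : R) : 0 < a -> 0 <= l -> - l <= t -> t <= a ->
  unstretch l t = t + l * ((a - t) / (a + l)).
Proof.
move=> a0 l0 t0 ta; have al : 0 < a + l by lra.
by rewrite /unstretch clamp01 // ?ler_pdivrMr ?divr_ge0 ?subr_ge0 //; lra.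
Qed.
Lemma unstretch_ge (l t : R) : 0 < a -> 0 <= l -> a <= t -> unstretch l t = t.
Proof.
move=> a0 l0 ta; have al : 0 < a + l by lra.
by rewrite /unstretch clamp_le0 ?mulr0 ?addr0 // pmulr_lle0 ?invr_gt0 //; lra.
Qed.

Lemma stretchK (l t : R) : 0 < a -> 0 <= l -> unstretch l (stretch l t) = t.
Proof.
move=> a0 l0; have [ta|ta] := leP a t; first by rewrite stretch_ge // unstretch_ge.
have [t0|t0] := leP t 0; first by rewrite stretch_le0 // unstretch_le; lra.
have h : 0 <= (a - t) / a by rewrite divr_ge0 //; lra.
have h1 : (a - t) / a <= 1 by rewrite ler_pdivrMr //; lra.
rewrite stretch_mid ?unstretch_mid //; try by [lra|nra].
by field; rewrite !lt0r_neq0 //; lra.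
Qed.

Lemma unstretchK (l t : R) : 0 < a -> 0 <= l -> stretch l (unstretch l t) = t.
Proof.
move=> a0 l0; have [ta|ta] := leP a t; first by rewrite unstretch_ge // stretch_ge.
have [t0|t0] := leP t (- l); first by rewrite unstretch_le // stretch_le0; lra.
have al : 0 < a + l by lra.
have E : t + l * ((a - t) / (a + l)) = a * (t + l) / (a + l) by field; rewrite lt0r_neq0.
rewrite unstretch_mid ?stretch_mid //; try lra.
- by field; rewrite !lt0r_neq0 //; lra.
- by rewrite E divr_ge0 ?mulr_ge0 //; lra.
- by rewrite E ler_pdivrMr // ler_pM2l //; lra.
Qed.

(** No point is raised beyond the level [a], so that the moves below do not leave
    the domain of a chart. *)
Lemma stretch_max (l t : R) : 0 < a -> 0 <= l -> stretch l t <= Num.max t a.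
Proof.
by move=> a0 l0; rewrite le_max /stretch gerBl mulr_ge0 // le_min ler01 le_max lexx.
Qed.

Lemma unstretch_max (l t : R) : 0 < a -> 0 <= l -> unstretch l t <= Num.max t a.
Proof.
move=> a0 l0; rewrite le_max; have [ta|ta] := leP a t; first by rewrite unstretch_ge ?lexx.
apply/orP; right; have [t0|t0] := leP t (- l); first by rewrite unstretch_le //; lra.
have al : 0 < a + l by lra.
rewrite (unstretch_mid a0 l0 (ltW t0) (ltW ta)) -lerBrDl mulrA ler_pdivrMr //; nra.
Qed.

Lemma unstretch_ge0 (l t : R) : 0 < a -> 0 <= l -> - l <= t -> 0 <= unstretch l t.
Proof.
move=> a0 l0 tl; have [ta|ta] := leP a t; first by rewrite unstretch_ge //; lra.
have al : 0 < a + l by lra.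
rewrite (unstretch_mid a0 l0 tl (ltW ta)).
have -> : t + l * ((a - t) / (a + l)) = a * (t + l) / (a + l) by field; rewrite lt0r_neq0.
by rewrite divr_ge0 ?mulr_ge0 //; lra.
Qed.

Lemma stretch0 t : stretch 0 t = t. Proof. by rewrite /stretch mul0r subr0. Qed.
Lemma unstretch0 t : unstretch 0 t = t. Proof. by rewrite /unstretch mul0r addr0. Qed.

End Stretch.

(** * Stretching an external collar inside one chart *)

Section ChartMove.
Variables (R : realType) (n : nat) (X : topologicalType) (B : set X).
Local Notation V := 'rV[R]_n.+1.
Variables (U : set X) (phi : X -> V) (g : V -> X) (c : V) (r : R).
Hypothesis ch : half_chart U phi g c r.
Hypothesis r_gt0 : 0 < r.
Hypothesis c0 : c ord0 ord0 = 0.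
Hypothesis BE : forall y, U y -> (B y <-> phi y ord0 ord0 = 0).
Local Notation Z := (@outer_collar R X B).

(** The chart [phi] extended to the external collar.  As [phi b] is on the
    hyperplane for [b] in [B], outer points go below the hyperplane, and
    [fold_collar] is the inverse. *)
Definition unfold_collar (p : X * R) : V := shift1 (phi p.1) (- p.2).
Definition fold_collar (y : V) : X * R := (g y, Num.max 0 (- y ord0 ord0)).
(** The foot of the vertical line through [y].  When [c] is on the hyperplane the
    foot of a point near [c] is near [c], because the norm is the maximum norm:
    the value of [lam] at the foot is therefore always defined. *)
Definition foot (y : V) : V := shift1 y (- y ord0 ord0).
Definition set_height (y : V) (t : R) : V := shift1 y (t - y ord0 ord0).

Lemma coord_subE (y z : V) i : (y - z) ord0 i = y ord0 i - z ord0 i.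
Proof. by rewrite !mxE. Qed.

Lemma height_set y t : set_height y t ord0 ord0 = t.
Proof. by rewrite shift1E eqxx addrC subrK. Qed.

Lemma foot_set_height y t : foot (set_height y t) = foot y.
Proof. by rewrite /foot height_set shift1D; congr shift1; ring. Qed.

Lemma set_height_set y t s : set_height (set_height y t) s = set_height y s.
Proof. by rewrite {1}/set_height height_set shift1D; congr shift1; ring. Qed.

Lemma set_height_id y : set_height y (y ord0 ord0) = y.
Proof. by rewrite /set_height subrr shift1_0. Qed.

Lemma retract_set_height_near y t : `|retract y - c| < r ->
  t <= Num.max (y ord0 ord0) (r / 2) -> `|retract (set_height y t) - c| < r.
Proof.
move=> yr ty; have r0 := r_gt0.
apply: (@le_lt_trans _ _ (Num.max (`|retract y - c|) (r / 2))); last first.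
  by rewrite gt_max yr; lra.
have m0 : 0 <= Num.max `|retract y - c| (r / 2) by rewrite le_max normr_ge0.
set m := Num.max _ _ in m0 *.
apply/rV_norm_leP => // i; have yi := rV_coord_norm_le (retract y - c) i.
have [i0|i0] := eqVneq i ord0; last first.
  rewrite /m le_max; apply/orP; left; apply: le_trans yi.
  by rewrite !coord_subE !shift1E (negPf i0) !addr0.
move: yi; rewrite i0 !coord_subE c0 !subr0 !retractE height_set.
have abs_max u : `|Num.max u 0 : R| = Num.max u 0 by rewrite ger0_norm // le_max lexx orbT.
rewrite !abs_max => yi.
rewrite ge_max m0 andbT; apply: (le_trans ty).
rewrite ge_max /m !le_max lexx orbT andbT; apply/orP; left.
by apply: le_trans yi; rewrite le_max lexx.
Qed.

Lemma foot_near y : `|retract y - c| < r ->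
  `|retract (foot y) - c| < r /\ retract (foot y) = foot y.
Proof.
move=> yr; have r0 := r_gt0; have -> : foot y = set_height y 0.
  by rewrite /set_height sub0r.
split; last by rewrite retract_id // height_set.
by apply: retract_set_height_near => //; rewrite le_max; apply/orP; right; lra.
Qed.

Lemma unfold_fold y : `|retract y - c| < r ->
  [/\ Z (fold_collar y), U (fold_collar y).1 & unfold_collar (fold_collar y) = y].
Proof.
case: ch => Uo phic phiU gU gc yr; have [Ugy phigy] := gU _ yr.
split=> //; last first.
  rewrite /unfold_collar /= phigy /retract shift1D subrr; exact: shift1_0.
rewrite /outer_collar /=; have [y0|y0] := leP (- y ord0 ord0) 0; [left|right].
  by [].
split; last exact: ltW.
by apply/(BE Ugy); rewrite phigy retractE max_r //; lra.
Qed.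

Lemma fold_unfold p : Z p -> U p.1 ->
  [/\ retract (unfold_collar p) = phi p.1, `|retract (unfold_collar p) - c| < r &
      fold_collar (unfold_collar p) = p].
Proof.
case: p => x t /= Zp Ux; have [Uo phic phiU gU gc] := ch.
have [phi0 phir gphi] := phiU _ Ux.
have y0 : unfold_collar (x, t) ord0 ord0 = phi x ord0 ord0 - t by rewrite shift1E eqxx.
have rE : retract (unfold_collar (x, t)) = phi x.
  case: Zp => /= [t0|[Bx t0]].
    rewrite retract_id; last by rewrite y0 t0 subr0.
    by rewrite /unfold_collar /= t0 oppr0 shift1_0.
  rewrite /retract y0 ((BE Ux).1 Bx) sub0r opprK max_r //.
  by rewrite /unfold_collar shift1D addNr shift1_0.
have yr : `|retract (unfold_collar (x, t)) - c| < r by rewrite rE.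
split=> //; have [Ug phig] := gU _ yr; congr (_, _).
  by have [_ _ <-] := phiU _ Ug; rewrite phig rE.
rewrite y0; case: Zp => /= [->|[Bx t0]]; last by rewrite ((BE Ux).1 Bx) sub0r opprK max_r.
by rewrite subr0 max_l // oppr_le0.
Qed.

Section Move.
Variables (lam : X -> R) (sigma : R -> R -> R).
Hypothesis lam_ge0 : forall x, 0 <= lam x.
Hypothesis sigma_max : forall l t, 0 <= l -> sigma l t <= Num.max t (r / 2).

(** Slides a point along the first axis, by an amount ruled by the value of [lam]
    at the foot, which does not change during the move. *)
Definition move_point (y : V) : V := set_height y (sigma (lam (g (foot y))) (y ord0 ord0)).

Definition chart_move (p : X * R) : X * R :=
  if pselect (U p.1) then fold_collar (move_point (unfold_collar p)) else p.

Lemma chart_moveE p : U p.1 -> chart_move p = fold_collar (move_point (unfold_collar p)).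
Proof. by rewrite /chart_move; case: pselect. Qed.

Lemma chart_move_notin p : ~ U p.1 -> chart_move p = p.
Proof. by rewrite /chart_move; case: pselect. Qed.

Lemma chart_moveP p : Z p -> U p.1 ->
  [/\ Z (chart_move p), U (chart_move p).1 &
      unfold_collar (chart_move p) = move_point (unfold_collar p)].
Proof.
move=> Zp Up; rewrite (chart_moveE Up).
have [_ yr _] := fold_unfold Zp Up.
apply: unfold_fold; apply: (retract_set_height_near yr); apply: sigma_max; exact: lam_ge0.
Qed.

Lemma chart_move_outer p : Z p -> Z (chart_move p).
Proof.
move=> Zp; have [Up|nUp] := pselect (U p.1); first by have [] := chart_moveP Zp Up.
by rewrite chart_move_notin.
Qed.

Definition collar_move (z : Z) : Z :=
  exist _ (chart_move (\val z)) (mem_set (chart_move_outer (set_mem (valP z)))).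

(** For outer points the foot is the image of the boundary point itself, hence
    the move is ruled by the value of [lam] there. *)
Lemma collar_move_boundary p : Z p -> U p.1 -> B p.1 ->
  unfold_collar (chart_move p) = set_height (phi p.1) (sigma (lam p.1) (- p.2)).
Proof.
move=> Zp Up Bp; have [_ _ ->] := chart_moveP Zp Up.
have phi0 := (BE Up).1 Bp; have [_ _ phiU _ _] := ch; have [_ _ gphi] := phiU _ Up.
have y0 : unfold_collar p ord0 ord0 = - p.2 by rewrite shift1E eqxx phi0 add0r.
have bE : foot (unfold_collar p) = phi p.1.
  by rewrite /foot y0 shift1D addrN shift1_0.
by rewrite /move_point bE gphi y0 {1}/set_height y0 shift1D /set_height phi0; congr shift1; ring.
Qed.

Hypothesis hX : hausdorff_space X.
Hypothesis lam_cont : continuous lam.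
Hypothesis lam_supp : forall x, lam x != 0 -> U x /\ `|phi x - c| <= r / 2.
Hypothesis sigma_cont : forall (T : topologicalType) (f h : T -> R) x,
  {for x, continuous f} -> {for x, continuous h} -> (forall x, 0 <= f x) ->
  {for x, continuous (fun x => sigma (f x) (h x))}.
Hypothesis sigma0 : forall t, sigma 0 t = t.
Hypothesis sigma_ge : forall l t, 0 <= l -> r / 2 <= t -> sigma l t = t.

(** It is the image of a compact half-ball; closedness in the whole of [X] is
    what allows the moves to be extended by the identity. *)
Lemma closed_support : closed [set x | U x /\ `|phi x - c| <= r / 2].
Proof.
have [Uo phic phiU gU gc] := ch; have r0 := r_gt0.
pose A := [set z : V | 0 <= z ord0 ord0 /\ `|z - c| <= r / 2].
have -> : [set x | U x /\ `|phi x - c| <= r / 2] = g @` A.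
  apply/seteqP; split=> [x [Ux xr]|_ [z [z0 zr] <-]].
    by have [x0 _ gx] := phiU _ Ux; exists (phi x).
  have [|Ug phig] := gU z; first by rewrite retract_id //; lra.
  by split=> //; rewrite phig retract_id.
apply: compact_closed => //; apply: continuous_compact.
  apply: continuous_in_subspaceT => z /set_mem[z0 zr].
  by apply: gc; rewrite retract_id //; lra.
exact: compact_half_ball.
Qed.

(** A vertical line on which some point moves has its foot in the half-size ball,
    and above the level [r / 2] nothing moves, so all the moving takes place
    over the compact half-ball of half size. *)
Lemma chart_move_off p : Z p -> ~ (U p.1 /\ `|phi p.1 - c| <= r / 2) -> chart_move p = p.
Proof.
move=> Zp nS; have [Up|nUp] := pselect (U p.1); last exact: chart_move_notin.
rewrite (chart_moveE Up).
have [rE yr fE] := fold_unfold Zp Up; set y := unfold_collar p in rE yr fE *.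
suff -> : move_point y = y by exact: fE.
have [bn bE] := foot_near yr; have [Uo phic phiU gU gc] := ch.
have [Ugb phigb] := gU _ bn.
have [ya|ya] := leP (r / 2) (y ord0 ord0).
  by rewrite /move_point sigma_ge // set_height_id.
have [l0|l0] := eqVneq (lam (g (foot y))) 0.
  by rewrite /move_point l0 sigma0 set_height_id.
have [_ bc] := lam_supp l0; rewrite phigb bE in bc.
case: nS; split=> //; rewrite -rE.
have r2 : 0 <= r / 2 by have := r_gt0; lra.
apply/rV_norm_leP => // i.
have [i0|i0] := eqVneq i ord0.
  rewrite i0 !coord_subE c0 !subr0 retractE ger0_norm ?le_max ?lexx ?orbT //.
  by rewrite ge_max r2 ltW.
apply: le_trans (le_trans (rV_coord_norm_le (foot y - c) i) bc).
by rewrite !coord_subE !shift1E (negPf i0) !addr0.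
Qed.

Lemma val_fst_continuous : continuous (fun z : Z => (\val z).1).
Proof.
move=> z; apply: (@continuous_comp _ _ _ (\val : Z -> X * R) fst); first exact: initial_continuous.
exact: cvg_fst.
Qed.

Lemma val_snd_continuous : continuous (fun z : Z => (\val z).2).
Proof.
move=> z; apply: (@continuous_comp _ _ _ (\val : Z -> X * R) snd); first exact: initial_continuous.
exact: cvg_snd.
Qed.

Lemma collar_move_continuous : continuous collar_move.
Proof.
apply: continuous_comp_initial => z.
have [Uo phic phiU gU gc] := ch.
have Zz := set_mem (valP z).
have [Uz|nUz] := pselect (U (\val z).1); last first.
  have nS : ~ [set x | U x /\ `|phi x - c| <= r / 2] (\val z).1 by case.
  have eq_id : nbhs z [set w : Z | (\val \o collar_move) w = \val w].
    have nb : nbhs z [set w : Z | ~ (U (\val w).1 /\ `|phi (\val w).1 - c| <= r / 2)].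
      exact: (val_fst_continuous (x := z) (open_nbhs_nbhs (conj (closed_openC closed_support) nS))).
    apply: filterS nb => w nSw /=; apply: chart_move_off => //; exact: set_mem (valP w).
  by apply: continuous_near_eq eq_id _; exact: initial_continuous.
pose y (w : Z) := unfold_collar (\val w).
have eq_move : nbhs z [set w : Z | (\val \o collar_move) w = fold_collar (move_point (y w))].
  have nb : nbhs z [set w : Z | U (\val w).1].
    exact: (val_fst_continuous (x := z) (open_nbhs_nbhs (conj Uo Uz))).
  by apply: filterS nb => w Uw /=; exact: chart_moveE.
apply: continuous_near_eq eq_move _.
have yc : {for z, continuous y}.
  apply: shift1_continuous; last by apply: oppr_continuous; exact: val_snd_continuous.
  apply: (@continuous_comp _ _ _ (fun w : Z => (\val w).1) phi); first exact: val_fst_continuous.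
  exact: phic.
have y0c : {for z, continuous (fun w => y w ord0 ord0)}.
  apply: (@continuous_comp _ _ _ y (fun v : V => v ord0 ord0)) => //; exact: coord0_continuous.
have [rE yr fE] := fold_unfold Zz Uz.
have [bn bE] := foot_near yr.
have lc : {for z, continuous (fun w => lam (g (foot (y w))))}.
  apply: (@continuous_comp _ _ _ (fun w => foot (y w)) (fun v => lam (g v))).
    by apply: shift1_continuous => //; exact: oppr_continuous.
  by apply: (@continuous_comp _ _ _ g lam); [exact: gc | exact: lam_cont].
have mc : {for z, continuous (fun w => move_point (y w))}.
  by apply: shift1_continuous => //; apply: subr_continuous => //; exact: sigma_cont.
have mr : `|retract (move_point (y z)) - c| < r.
  by apply: (retract_set_height_near yr); exact: sigma_max.
have gmc : {for z, continuous (fun w => g (move_point (y w)))}.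
  by apply: (@continuous_comp _ _ _ (fun w => move_point (y w)) g) => //; exact: gc.
have hmc : {for z, continuous (fun w => Num.max 0 (- move_point (y w) ord0 ord0))}.
  apply: maxr_continuous; first exact: cstr_continuous.
  apply: oppr_continuous.
  apply: (@continuous_comp _ _ _ (fun w => move_point (y w)) (fun v : V => v ord0 ord0)) => //.
  exact: coord0_continuous.
exact: (cvg_pair gmc hmc).
Qed.

End Move.

Lemma collar_move_cancel (lam : X -> R) (s1 s2 : R -> R -> R)
    (l0 : forall x, 0 <= lam x) (h1 : forall l t, 0 <= l -> s1 l t <= Num.max t (r / 2))
    (h2 : forall l t, 0 <= l -> s2 l t <= Num.max t (r / 2)) :
  (forall l t, 0 <= l -> s2 l (s1 l t) = t) ->
  cancel (collar_move l0 h1) (collar_move l0 h2).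
Proof.
move=> s12 z; apply: val_inj => /=; have Zz := set_mem (valP z).
have [Uz|nUz] := pselect (U (\val z).1); last first.
  by rewrite !chart_move_notin.
have [Zm Um mE] := chart_moveP l0 h1 Zz Uz.
rewrite chart_moveE // mE.
have [_ _ fE] := fold_unfold Zz Uz.
rewrite -[RHS]fE; congr fold_collar.
rewrite /move_point foot_set_height height_set s12 // set_height_set.
exact: set_height_id.
Qed.

Lemma stretch_continuous (T : topologicalType) (f h : T -> R) x :
  {for x, continuous f} -> {for x, continuous h} -> (forall x, 0 <= f x) ->
  {for x, continuous (fun x => stretch (r / 2) (f x) (h x))}.
Proof.
move=> fc hc _; apply: subr_continuous => //; apply: mulr_continuous => //.
apply: minr_continuous; first exact: cstr_continuous.
apply: maxr_continuous; first exact: cstr_continuous.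
apply: mulr_continuous; last exact: cstr_continuous.
by apply: subr_continuous => //; exact: cstr_continuous.
Qed.

Lemma unstretch_continuous (T : topologicalType) (f h : T -> R) x :
  {for x, continuous f} -> {for x, continuous h} -> (forall x, 0 <= f x) ->
  {for x, continuous (fun x => unstretch (r / 2) (f x) (h x))}.
Proof.
move=> fc hc f0; apply: addr_continuous => //; apply: mulr_continuous => //.
apply: minr_continuous; first exact: cstr_continuous.
apply: maxr_continuous; first exact: cstr_continuous.
apply: mulr_continuous.
  by apply: subr_continuous => //; exact: cstr_continuous.
apply: invr_continuous.
  by apply: addr_continuous => //; exact: cstr_continuous.
by have := r_gt0; have := f0 x => ? ?; apply/lt0r_neq0; lra.
Qed.

Lemma fibre_shift_in_chart (lam : X -> R) : hausdorff_space X ->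
  continuous lam -> (forall x, 0 <= lam x) ->
  (forall x, lam x != 0 -> U x /\ `|phi x - c| <= r / 2) ->
  exists up down, fibre_shift (B := B) lam up down.
Proof.
move=> hX lamc lam0 lamS; have r20 : 0 < r / 2 by rewrite divr_gt0.
have umax l t := @unstretch_max R (r / 2) l t r20.
have smax l t := @stretch_max R (r / 2) l t r20.
exists (collar_move lam0 umax), (collar_move lam0 smax).
have lam_out p : ~ U p -> lam p = 0.
  by move=> nU; apply/eqP; apply: contraT => /lamS[].
split.
- apply: collar_move_continuous => //; first exact: unstretch_continuous.
    exact: unstretch0.
  by move=> l t l0 ?; exact: unstretch_ge.
- apply: collar_move_continuous => //; first exact: stretch_continuous.
    exact: stretch0.
  by move=> l t l0 ?; exact: stretch_ge.
- by apply: collar_move_cancel => l t l0; exact: unstretchK.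
- by apply: collar_move_cancel => l t l0; exact: stretchK.
split=> z; have Zz := set_mem (valP z).
- rewrite -[\val (collar_move _ _ z)]/(chart_move lam _ (\val z)); 
  move: (\val z) Zz => [b t] Zz /= Bb lt.
  have [Ub|nUb] := pselect (U b); last first.
    by rewrite chart_move_notin //= lam_out // subr0.
  have [Zm Um _] := chart_moveP lam0 umax Zz Ub.
  have := collar_move_boundary lam0 umax Zz Ub Bb; rewrite unstretch_le //=; last lra.
  have Zq : Z (b, t - lam b) by right; split=> //=; lra.
  have [_ _ qE] := fold_unfold Zq Ub; have [_ _ mE] := fold_unfold Zm Um.
  move=> yE; rewrite -mE -qE yE; congr fold_collar.
  by rewrite /set_height /unfold_collar /= ((BE Ub).1 Bb); congr shift1; ring.
- rewrite -[\val (collar_move _ _ z)]/(chart_move lam _ (\val z)) => zl; move: zl.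
  move: (\val z) Zz => [b t] Zz /= tl.
  have [Ub|nUb] := pselect (U b); last first.
    rewrite chart_move_notin //=. case: tl => //; rewrite lam_out // => t0.
    by case: Zz => /= [//|[_ t0']]; apply/eqP; rewrite eq_le t0.
  rewrite (chart_moveE lam _ (p := (b, t)) Ub) /=; apply/max_l; rewrite oppr_le0.
  have [_ _ yE] := chart_moveP lam0 umax Zz Ub.
  rewrite height_set; apply: unstretch_ge0 => //.
  have [_ _ phiU _ _] := ch; have [phi0 _ gphi] := phiU _ Ub.
  have y0 : unfold_collar (b, t) ord0 ord0 = phi b ord0 ord0 - t by rewrite shift1E eqxx.
  have [t0|t0] := eqVneq t 0.
    by have := lam0 (g (foot (unfold_collar (b, t)))); rewrite y0; lra.
  case: Zz => /= [/eqP|[Bb _]]; first by rewrite (negPf t0).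
  have bE : foot (unfold_collar (b, t)) = phi b.
    by rewrite /foot y0 ((BE Ub).1 Bb) sub0r /unfold_collar shift1D addrN shift1_0.
  rewrite bE gphi y0 ((BE Ub).1 Bb); case: tl => [tz|]; last lra.
  by rewrite tz eqxx in t0.
Qed.

(** The bump is the distance to the complement of the half-size ball, truncated
    at 1. *)
Lemma bump_in_chart (x : X) : hausdorff_space X -> U x -> phi x = c ->
  exists2 mu : X -> R, bump B mu & 0 < mu x.
Proof.
move=> hX Ux xc; have [Uo phic phiU gU gc] := ch.
pose h y := Num.min 1 (Num.max 0 (r / 2 - `|phi y - c|)).
pose mu y := if pselect (U y) then h y else 0.
have hc y : U y -> {for y, continuous h}.
  move=> Uy; apply: minr_continuous; first exact: cstr_continuous.
  apply: maxr_continuous; first exact: cstr_continuous.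
  apply: subr_continuous; first exact: cstr_continuous.
  by apply: dist_continuous; exact: phic.
have muE y : U y -> mu y = h y by rewrite /mu; case: pselect.
have mu_supp y : mu y != 0 -> U y /\ `|phi y - c| <= r / 2.
  rewrite /mu; case: pselect => [Uy|nU] /=; last by rewrite eqxx.
  move=> h0; split=> //; rewrite leNgt; apply: contra h0 => yr.
  by rewrite /h clamp_le0 // subr_le0 ltW.
have mu01 y : 0 <= mu y <= 1.
  rewrite /mu; case: pselect => [Uy|nU] /=; last by rewrite lexx ler01.
  by rewrite /h le_min ler01 le_max lexx ge_min lexx.
exists mu; last first.
  have := r_gt0; rewrite muE // /h xc subrr normr0 subr0 => r0.
  by rewrite lt_min ltr01 lt_max divr_gt0 ?orbT.
split=> // [y|lam lamc lam0 lamS]; last first.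
  by apply: fibre_shift_in_chart => // y /lamS; exact: mu_supp.
have [Uy|nU] := pselect (U y).
  have nb : nbhs y [set w | mu w = h w].
    by apply: filterS (open_nbhs_nbhs (conj Uo Uy)) => w; exact: muE.
  exact: (continuous_near_eq nb (hc y Uy)).
have nS : ~ [set x | U x /\ `|phi x - c| <= r / 2] y by case.
have nb : nbhs y [set w | mu w = 0].
  apply: filterS (open_nbhs_nbhs (conj (closed_openC (closed_support hX)) nS)) => w nSw /=.
  by apply/eqP; apply: contraT => /mu_supp.
by apply: (continuous_near_eq nb); exact: cstr_continuous.
Qed.

End ChartMove.

Lemma bump_at (R : realType) (n : nat) (X : topologicalType) (x : X) :
  hausdorff_space X -> manifold_boundary R n.+1 X x ->
  exists2 mu : X -> R, bump (manifold_boundary R n.+1 X) mu & 0 < mu x.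
Proof.
move=> hX /boundary_half_chart[U [phi [g [r [ch r0 Ux x0 BE]]]]].
exact: (bump_in_chart ch r0 x0 BE hX Ux).
Qed.

(** * Locally finite families of bumps *)

(** Openness at each point suffices for the inverse to be continuous and for the
    range to be open. *)
Lemma open_injection_embedding (S T : topologicalType) (f : S -> T) :
  continuous f -> injective f ->
  (forall x W, nbhs x W -> nbhs (f x) (f @` W)) ->
  embedding f /\ open (range f).
Proof.
move=> fc finj fo; split; last first.
  by rewrite openE => _ [x _ <-]; apply: fo; exact: filterT.
split; first by apply: continuous_comp_initial.
have pre (w : range f) : {x | f x = \val w}.
  by apply: cid; have [x _ xw] := set_mem (valP w); exists x.
exists (fun w => sval (pre w)); split.
- move=> w W; case: (pre w) => x /= xw xW.
  have := fo x W xW; rewrite xw => nW.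
  have : nbhs w [set v : range f | (f @` W) (\val v)] by exact: (initial_continuous nW).
  apply: filterS => v [y Wy yv] /=; case: (pre v) => x' /= x'v.
  by rewrite (finj x' y) // x'v yv.
- by move=> x; case: (pre _) => y /= /finj.
- by move=> w; apply: val_inj => /=; case: (pre _).
Qed.

Section Bumps.
Variables (R : realType) (X : topologicalType) (B : set X).

Lemma bump0 : bump B (fun=> 0 : R).
Proof.
split=> [x|x|lam _ _ lam0]; first exact: cstr_continuous.
  by rewrite lexx ler01.
have {}lam0 x : lam x = 0.
  by apply/eqP; apply: contraT => /lam0; rewrite eqxx.
exists id, id; split=> //; try by move=> z; exact: cvg_id.
split=> z; first by rewrite lam0 subr0; case: (\val z).
rewrite lam0; case=> // z0; have [//|[_ z0']] := set_mem (valP z).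
by apply/eqP; rewrite eq_le z0.
Qed.

(** Lindelof property: for each set of a countable basis choose a bump positive
    on it, whenever there is one. *)
Lemma bump_sequence : @second_countable X ->
  (forall x, B x -> exists2 mu : X -> R, bump B mu & 0 < mu x) ->
  exists mu : nat -> X -> R, (forall k, bump B (mu k)) /\
    forall x, B x -> exists k, 0 < mu k x.
Proof.
move=> [base cbase [baseO baseP]] bumps.
have /choice[M MP] : forall A : set X, exists nu : X -> R, bump B nu /\
    forall mu : X -> R, bump B mu -> (forall x, A x -> 0 < mu x) ->
    forall x, A x -> 0 < nu x.
  move=> A; have [[nu [nub nuA]]|none] := pselect (exists nu : X -> R, bump B nu /\
      forall x, A x -> 0 < nu x).
    by exists nu; split.
  exists (fun=> 0); split; first exact: bump0.
  by move=> mu mub muA; case: none; exists mu.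
have /countable_injP[f finj] := cbase.
have /choice[A AP] : forall k, exists A : set X, forall A', base A' -> f A' = k -> A = A'.
  move=> k; have [[A [Ab Ak]]|none] := pselect (exists A, base A /\ f A = k).
    by exists A => A' A'b A'k; apply: finj; rewrite ?inE // Ak.
  by exists set0 => A' A'b A'k; case: none; exists A'.
exists (fun k => M (A k)); split=> [k|x Bx]; first by case: (MP (A k)).
have [mu mub mux] := bumps x Bx.
have pos : nbhs x [set y | 0 < mu y].
  apply: open_nbhs_nbhs; split=> //.
  apply: (@open_comp _ _ mu [set t | 0 < t]); last exact: open_gt.
  by move=> y _; case: mub.
have [D [baseD Dx] Dpos] := baseP x _ pos.
exists (f D); have [_ MA] := MP (A (f D)).
by rewrite (AP (f D) D) // in MA *; exact: (MA mu).
Qed.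

(** Mather's trick: [lam k] is the positive part of [mu k] minus [k] times the sum
    of the previous [mu j].  At a point of [B] the first nonzero [mu k] is kept,
    and [mu k] remains at least some [e] nearby, so that the functions of index
    greater than [k] and at least [1 / e] vanish there. *)
Lemma locally_finite_bumps (mu : nat -> X -> R) :
  (forall k, bump B (mu k)) -> (forall x, B x -> exists k, 0 < mu k x) ->
  exists lam : nat -> X -> R,
    [/\ forall k, continuous (lam k), forall k x, 0 <= lam k x,
        forall k x, lam k x != 0 -> mu k x != 0 &
        forall x, B x -> exists m (N : set X), [/\ open N, N x,
          forall y, N y -> 0 < \sum_(j < m) lam j y &
          forall y k, N y -> (m <= k)%N -> lam k y = 0]].
Proof.
move=> mub muB.
have mu_cont k : continuous (mu k) by case: (mub k).
have mu_ge0 k x : 0 <= mu k x by have [_ /(_ x)/andP[]] := mub k.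
have mu_le1 k x : mu k x <= 1 by have [_ /(_ x)/andP[]] := mub k.
have sum_cont (h : nat -> X -> R) m : (forall k, continuous (h k)) ->
    continuous (fun x => \sum_(j < m) h j x).
  move=> hc; elim: m => [|m IH] x.
    by under eq_fun do rewrite big_ord0; exact: cstr_continuous.
  by under eq_fun do rewrite big_ord_recr /=; apply: addr_continuous; [exact: IH|exact: hc].
pose lam k x := Num.max 0 (mu k x - k%:R * \sum_(j < k) mu j x).
have lam_cont k : continuous (lam k).
  move=> x; apply: (@maxr_continuous R X (fun=> 0)
    (fun x => mu k x - k%:R * \sum_(j < k) mu j x)).
    exact: cstr_continuous.
  apply: subr_continuous; first exact: mu_cont.
  by apply: mulr_continuous; [exact: cstr_continuous|exact: sum_cont].
have lam_ge0 k x : 0 <= lam k x by rewrite le_max lexx.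
exists lam; split=> //.
  move=> k x; apply: contraNneq => mu0; rewrite /lam mu0 sub0r max_l // oppr_le0.
  by rewrite mulr_ge0 // sumr_ge0.
move=> x /muB exk; pose k0 := ex_minn exk.
have [k0P k0min] : 0 < mu k0 x /\ forall j, (j < k0)%N -> mu j x = 0.
  rewrite /k0; case: ex_minnP => k kP kmin; split=> // j jk.
  apply/eqP; rewrite eq_le mu_ge0 andbT leNgt; apply/negP => /kmin.
  by rewrite leqNgt jk.
have lamk0 : 0 < lam k0 x.
  rewrite /lam big1 ?mulr0 ?subr0 ?lt_max ?k0P ?orbT // => j _; exact: k0min.
pose e := mu k0 x / 2; have e0 : 0 < e by rewrite divr_gt0.
have [m0 m0P] : exists m0 : nat, 1 / e < m0%:R.
  by have [m0 _ m0P] := nbhs_infty_gtr (1 / e); exists m0; apply: m0P => /=.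
pose m := (maxn k0.+1 m0).
exists m, [set y | e < mu k0 y /\ 0 < lam k0 y]; split.
- apply: openI.
    apply: (@open_comp _ _ (mu k0) [set t | e < t]);
      [move=> y _; exact: mu_cont|exact: open_gt].
  apply: (@open_comp _ _ (lam k0) [set t | 0 < t]);
    [move=> y _; exact: lam_cont|exact: open_gt].
- by split=> //; rewrite /e; lra.
- have k0m : (k0 < m)%N by rewrite leq_max leqnn.
  move=> y [_ ly]; rewrite (bigD1 (Ordinal k0m)) //=.
  by apply: ltr_wpDr => //; exact: sumr_ge0.
- move=> y k [ey _] mk; have k0k : (k0 < k)%N by apply: leq_trans mk; rewrite leq_max leqnn.
  rewrite /lam max_l // subr_le0; apply: le_trans (mu_le1 k y) _.
  have kS : e <= \sum_(j < k) mu j y.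
    rewrite (bigD1 (Ordinal k0k)) //=; apply: (le_trans (ltW ey)).
    by rewrite lerDl sumr_ge0.
  apply: (@le_trans _ _ (k%:R * e)); last by rewrite ler_wpM2l.
  rewrite -ler_pdivrMr //; apply: (le_trans (ltW m0P)); rewrite ler_nat.
  by apply: leq_trans mk; rewrite leq_max leqnn orbT.
Qed.

End Bumps.

(** * From infinitely many stretches to a collar *)

Section Assembly.
Variables (R : realType) (X : topologicalType) (B : set X).
Local Notation Z := (@outer_collar R X B).
Local Notation I := (half_open_unit_interval R).
Variables (lam : nat -> X -> R) (up down : nat -> Z -> Z).
Hypothesis lam_cont : forall k, continuous (lam k).
Hypothesis lam_ge0 : forall k x, 0 <= lam k x.
Hypothesis shift_ud : forall k, fibre_shift (lam k) (up k) (down k).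

Definition total_shift (k : nat) (x : X) : R := \sum_(j < k) lam j x.

(** The map of largest index is applied first.  In this order the sequence of
    images of an outer point is eventually constant. *)
Fixpoint ups (k : nat) (z : Z) : Z := if k is k'.+1 then ups k' (up k' z) else z.
Fixpoint downs (k : nat) (z : Z) : Z := if k is k'.+1 then down k' (downs k' z) else z.

Lemma total_shift_continuous k : continuous (total_shift k).
Proof.
elim: k => [|k IH] x.
  rewrite (_ : total_shift 0 = fun=> 0); first exact: cstr_continuous.
  by apply/funext => y; rewrite /total_shift big_ord0.
rewrite (_ : total_shift k.+1 = fun y => total_shift k y + lam k y).
  by apply: addr_continuous; [exact: IH|exact: lam_cont].
by apply/funext => y; rewrite /total_shift big_ord_recr.
Qed.

Lemma total_shift_ge0 k x : 0 <= total_shift k x.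
Proof. by apply: sumr_ge0 => j _. Qed.

Lemma total_shiftS k x : total_shift k.+1 x = total_shift k x + lam k x.
Proof. by rewrite /total_shift big_ord_recr. Qed.

Lemma ups_continuous k : continuous (ups k).
Proof.
elim: k => [|k IH] z /=; first exact: cvg_id.
have [upc _ _ _ _] := shift_ud k.
by apply: (@continuous_comp _ _ _ (up k) (ups k)); [exact: upc|exact: IH].
Qed.

Lemma downs_continuous k : continuous (downs k).
Proof.
elim: k => [|k IH] z /=; first exact: cvg_id.
have [_ downc _ _ _] := shift_ud k.
by apply: (@continuous_comp _ _ _ (downs k) (down k)); [exact: IH|exact: downc].
Qed.

Lemma upsK k : cancel (ups k) (downs k).
Proof.
elim: k => [|k IH] z //=; have [_ _ upK _ _] := shift_ud k.
by rewrite IH upK.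
Qed.

Lemma downsK k : cancel (downs k) (ups k).
Proof.
elim: k => [|k IH] z //=; have [_ _ _ downK _] := shift_ud k.
by rewrite downK IH.
Qed.

(** Outer points above the total height are only lowered. *)
Lemma ups_shift k z : B (\val z).1 -> total_shift k (\val z).1 <= (\val z).2 ->
  \val (ups k z) = ((\val z).1, (\val z).2 - total_shift k (\val z).1).
Proof.
elim: k z => [|k IH] z Bz /=.
  by rewrite /total_shift big_ord0 subr0; case: (\val z).
rewrite total_shiftS => uz; have [_ _ _ _ [upE _]] := shift_ud k.
have u0 := total_shift_ge0 k (\val z).1.
have {}upE : \val (up k z) = ((\val z).1, (\val z).2 - lam k (\val z).1).
  by apply: upE => //; lra.
rewrite IH upE //=; last by lra.
by congr (_, _); ring.
Qed.

(** Once a point has reached [X], the further maps keep it in [X]. *)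
Lemma ups_floor k z : (\val z).2 = 0 \/ (\val z).2 <= total_shift k (\val z).1 ->
  (\val (ups k z)).2 = 0.
Proof.
elim: k z => [|k IH] z /=.
  rewrite /total_shift big_ord0 => -[//|z0].
  have [//|[_ z0']] := set_mem (valP z).
  by apply/eqP; rewrite eq_le z0.
have [_ _ _ _ [upE up0]] := shift_ud k.
rewrite total_shiftS => zu; apply: IH.
have [zl|zl] := leP (\val z).2 (lam k (\val z).1); first by left; apply: up0; right.
case: zu => [z0|zu]; first by left; apply: up0; left.
right; have [z0|[Bz _]] := set_mem (valP z).
  by have := lam_ge0 k (\val z).1; rewrite -z0 leNgt zl.
by rewrite (upE _ Bz (ltW zl)) /= lerBlDr.
Qed.

Lemma outer_point_subproof (b : B) (t : R) : (\val b, Num.max 0 t) \in Z.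
Proof. by apply/mem_set; right; split; [exact: set_mem (valP b)|rewrite le_max lexx]. Qed.

(** The height is truncated at 0 so that no proof of positivity is carried
    around. *)
Definition outer_point (b : B) (t : R) : Z :=
  exist _ (\val b, Num.max 0 t) (outer_point_subproof b t).

Lemma floor_point_subproof (x : X) : (x, 0) \in Z.
Proof. by apply/mem_set; left. Qed.

Definition floor_point (x : X) : Z := exist _ (x, 0) (floor_point_subproof x).

Lemma val_outer_point b t : 0 <= t -> \val (outer_point b t) = (\val b, t).
Proof. by move=> t0; rewrite /= max_r. Qed.

(** The collar built from the first [k] shifts: the outer interval above [b] of
    length [total_shift k b] is run through downwards, so that [s = 0] gives its
    top, which [ups k] sends to [b], and is sent into [X]. *)
Definition stage (k : nat) (p : B * I) : Z :=
  ups k (outer_point p.1 (total_shift k (\val p.1) * (1 - \val p.2))).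

Lemma unit_intervalP (t : I) : 0 <= \val t /\ \val t < 1.
Proof. by have := set_mem (valP t); rewrite /half_open_unit_interval /= in_itv /= => /andP. Qed.

Lemma depth_ge0 k (p : B * I) : 0 <= total_shift k (\val p.1) * (1 - \val p.2).
Proof.
have [t0 t1] := unit_intervalP p.2.
by rewrite mulr_ge0 ?total_shift_ge0 // subr_ge0 ltW.
Qed.

Lemma stage_floor k p : (\val (stage k p)).2 = 0.
Proof.
apply: ups_floor; right; rewrite val_outer_point ?depth_ge0 //=.
have [t0 t1] := unit_intervalP p.2.
by apply: ler_piMr; [exact: total_shift_ge0|rewrite gerBl].
Qed.

Lemma stage_continuous k : continuous (stage k).
Proof.
move=> p; apply: (@continuous_comp _ _ _
  (fun p : B * I => outer_point p.1 (total_shift k (\val p.1) * (1 - \val p.2))) (ups k));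
  last exact: ups_continuous.
move: p; apply: continuous_comp_initial => p.
have v1 : {for p, continuous (fun p : B * I => \val p.1)}.
  apply: (@continuous_comp _ _ _ (@fst B I) (\val : B -> X)); first exact: cvg_fst.
  exact: initial_continuous.
have v2 : {for p, continuous (fun p : B * I => \val p.2)}.
  apply: (@continuous_comp _ _ _ (@snd B I) (\val : I -> R)); first exact: cvg_snd.
  exact: initial_continuous.
have hc : {for p, continuous (fun p : B * I =>
    Num.max 0 (total_shift k (\val p.1) * (1 - \val p.2)))}.
  apply: maxr_continuous; first exact: cstr_continuous.
  apply: mulr_continuous.
    apply: (@continuous_comp _ _ _ (fun p : B * I => \val p.1) (total_shift k)) => //.
    exact: total_shift_continuous.
  by apply: subr_continuous => //; exact: cstr_continuous.
exact: (cvg_pair v1 hc).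
Qed.

Hypothesis locally_finite : forall x, B x -> exists m (N : set X), [/\ open N, N x,
  forall y, N y -> 0 < total_shift m y &
  forall y k, N y -> (m <= k)%N -> lam k y = 0].

(** The shifts of index at least [m] fix the outer points above [p.1]. *)
Lemma stage_eq k m p : (m <= k)%N -> (forall j, (m <= j)%N -> lam j (\val p.1) = 0) ->
  stage k p = stage m p.
Proof.
move=> mk lam0; elim: k mk => [|k IH]; first by rewrite leqn0 => /eqP ->.
rewrite leq_eqVlt => /orP[/eqP->//|]; rewrite ltnS => mk.
rewrite -IH // /stage /= total_shiftS lam0 // addr0; congr ups; apply: val_inj.
have [_ _ _ _ [upE _]] := shift_ud k.
have d0 := depth_ge0 k p; 
have := upE (outer_point p.1 (total_shift k (\val p.1) * (1 - \val p.2))).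
by rewrite val_outer_point //= lam0 // subr0; apply => //; exact: set_mem (valP p.1).
Qed.

(** The map [f] is locally equal to a single [stage], hence continuous, and two
    given points are compared in a common [stage], hence it is injective.  It
    is open because [downs k] carries a point [x] close to [f p] to an outer
    point, whose height must be at most the total shift and thus is the height
    used by [stage k] for some [s]. *)
Lemma collared_of_fibre_shifts : collared R B.
Proof.
have /choice[m mP] : forall b : B, exists m, exists N : set X, [/\ open N, N (\val b),
    forall y, N y -> 0 < total_shift m y & forall y k, N y -> (m <= k)%N -> lam k y = 0].
  by move=> b; exact: locally_finite (set_mem (valP b)).
pose f (p : B * I) := (\val (stage (m p.1) p)).1.
have fE (p : B * I) k : (m p.1 <= k)%N -> f p = (\val (stage k p)).1.
  move=> mk; rewrite /f (stage_eq mk) // => j mj.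
  by have [N [_ Nb _]] := mP p.1; apply.
have f_near (b : B) : exists2 N : set X, open N /\ N (\val b) &
    forall p : B * I, N (\val p.1) -> f p = (\val (stage (m b) p)).1 /\
      0 < total_shift (m b) (\val p.1).
  have [N [No Nb Npos N0]] := mP b; exists N => // p Np; split; last exact: Npos.
  rewrite (fE p _ (leq_maxl (m p.1) (m b))) (stage_eq (leq_maxr (m p.1) (m b))) //.
  by move=> j mj; exact: N0.
have fstZ : continuous (fun z : Z => (\val z).1) by exact: val_fst_continuous.
have val1 : continuous (fun p : B * I => \val p.1).
  move=> p; apply: (@continuous_comp _ _ _ (@fst B I) (\val : B -> X)); first exact: cvg_fst.
  exact: initial_continuous.
have fc : continuous f.
  move=> p; have [N [No Np] fN] := f_near p.1.
  have nb : nbhs p [set q : B * I | f q = (\val (stage (m p.1) q)).1].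
    have nN : nbhs p [set q : B * I | N (\val q.1)].
      exact: (val1 p _ (open_nbhs_nbhs (conj No Np))).
    by apply: filterS nN => q /fN[].
  apply: (continuous_near_eq nb).
  apply: (@continuous_comp _ _ _ (stage (m p.1)) (fun z : Z => (\val z).1)).
    exact: stage_continuous.
  exact: fstZ.
have finj : injective f.
  move=> p q; pose k := maxn (m p.1) (m q.1).
  rewrite (fE p k) ?leq_maxl // (fE q k) ?leq_maxr // => pq.
  have /(can_inj (upsK k)) : stage k p = stage k q.
    apply: val_inj; move: (stage_floor k p) (stage_floor k q) pq.
    by case: (\val (stage k p)) => a s; case: (\val (stage k q)) => b t /= -> -> ->.
  move/(congr1 \val); rewrite !val_outer_point ?depth_ge0 // => -[pq1].
  rewrite pq1 => /mulfI; have upos : 0 < total_shift k (\val q.1).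
    have [N [No Nq] fN] := f_near q.1; have [_ upos] := fN q Nq.
    apply: (lt_le_trans upos); rewrite /total_shift.
    rewrite -(big_mkord predT (fun j => lam j (\val q.1))).
    rewrite -[leRHS](big_mkord predT (fun j => lam j (\val q.1))).
    rewrite (big_cat_nat _ (leq_maxr (m p.1) (m q.1))) //= lerDl.
    by apply: sumr_ge0.
  move=> /(_ (lt0r_neq0 upos)) /addrI/oppr_inj pq2.
  case: p q pq1 pq2 {pq upos k} => [b s] [b' s'] /= h1 h2.
  by congr (_, _); apply: val_inj.
have fopen p W : nbhs p W -> nbhs (f p) (f @` W).
  move=> [[W1 W2] /= [nW1 nW2] W12].
  have [N [No Np] fN] := f_near p.1; set k := m p.1 in fN.
  have [fpE upos] := fN p Np.
  have [D1 D1p D1W] : exists2 D1 : set X, nbhs (\val p.1) D1 &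
      forall b : B, D1 (\val b) -> W1 b.
    case: nW1 => _ [[D Do <-] /= Dp DW].
    by exists D; [exact: open_nbhs_nbhs|exact: DW].
  have [D2 D2p D2W] : exists2 D2 : set R, nbhs (\val p.2) D2 &
      forall t : I, D2 (\val t) -> W2 t.
    case: nW2 => _ [[D Do <-] /= Dp DW].
    by exists D; [exact: open_nbhs_nbhs|exact: DW].
  pose h x := downs k (floor_point x).
  have hfp : h (f p) = outer_point p.1 (total_shift k (\val p.1) * (1 - \val p.2)).
    rewrite /h -[RHS](upsK k) -/(stage k p); congr downs; apply: val_inj.
    by rewrite [RHS]surjective_pairing (stage_floor k p) -fpE.
  have hc : continuous h.
    move=> x; apply: (@continuous_comp _ _ _ floor_point (downs k)); last exact: downs_continuous.
    move: x; apply: continuous_comp_initial => x.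
    exact: (cvg_pair (@cvg_id _ (nbhs x)) (@cstr_continuous R X x 0)).
  have h1 : continuous (fun x => (\val (h x)).1).
    by move=> x; apply: (@continuous_comp _ _ _ h (fun z : Z => (\val z).1)); [exact: hc|exact: fstZ].
  have h2 : continuous (fun x => (\val (h x)).2).
    move=> x; apply: (@continuous_comp _ _ _ h (fun z : Z => (\val z).2)); first exact: hc.
    exact: val_snd_continuous.
  have d_gt0 : 0 < total_shift k (\val p.1) * (1 - \val p.2).
    by rewrite mulr_gt0 // subr_gt0; have [] := unit_intervalP p.2.
  have e1 : (\val (h (f p))).1 = \val p.1 by rewrite hfp.
  have e2 : (\val (h (f p))).2 = total_shift k (\val p.1) * (1 - \val p.2).
    by rewrite hfp val_outer_point ?ltW.
  (* The parameter of [x] in the collar, read off its image under [downs k]. *)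
pose s x := 1 - (\val (h x)).2 / total_shift k (\val (h x)).1.
  have sp : s (f p) = \val p.2 by rewrite /s e1 e2; field; exact: lt0r_neq0.
  have sc : {for f p, continuous s}.
    apply: subr_continuous; first exact: cstr_continuous.
    apply: mulr_continuous; first exact: h2.
    apply: invr_continuous; last by rewrite e1; exact: lt0r_neq0.
    apply: (@continuous_comp _ _ _ (fun x => (\val (h x)).1) (total_shift k)); first exact: h1.
    exact: total_shift_continuous.
  have n1 : nbhs (f p) [set x | N (\val (h x)).1].
    by apply: (h1 (f p)); rewrite e1; exact: open_nbhs_nbhs.
  have n2 : nbhs (f p) [set x | D1 (\val (h x)).1] by apply: (h1 (f p)); rewrite e1.
  have n3 : nbhs (f p) [set x | 0 < (\val (h x)).2].
    have pos : nbhs (\val (h (f p))).2 [set t : R | 0 < t].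
      by rewrite e2; exact: (open_nbhs_nbhs (conj (@open_gt R 0) d_gt0)).
    exact: (h2 (f p) _ pos).
  have n4 : nbhs (f p) [set x | D2 (s x)] by apply: sc; rewrite sp.
  near=> x.
  have hx1 : N (\val (h x)).1 by near: x.
  have hx2 : D1 (\val (h x)).1 by near: x.
  have hx3 : 0 < (\val (h x)).2 by near: x.
  have hx4 : D2 (s x) by near: x.
  have Bhx : B (\val (h x)).1.
    have [h0|[]//] := set_mem (valP (h x)).
    by rewrite h0 ltxx in hx3.
  pose b : B := exist _ (\val (h x)).1 (mem_set Bhx).
  have upos' : 0 < total_shift k (\val b).
    by have [_] := fN (b, p.2) hx1.
  have hxu : (\val (h x)).2 <= total_shift k (\val b).
    (* A higher point would be sent by [ups k] strictly above the floor. *)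
    rewrite leNgt; apply/negP => uh.
    have := ups_shift (k := k) Bhx (ltW uh); rewrite /h downsK => /(congr1 snd) /= /esym/eqP.
    by rewrite subr_eq0 -/(h x) => /eqP hE; move: uh; rewrite /= hE ltxx.
  have sI : s x \in I.
    apply/mem_set; rewrite /half_open_unit_interval /= in_itv /=; apply/andP; split.
      by rewrite /s subr_ge0 ler_pdivrMr // mul1r.
    by rewrite /s gtrBl divr_gt0.
  pose t : I := exist _ (s x) sI.
  exists (b, t); first by apply: W12; split; [exact: D1W|exact: D2W].
  have [-> _] := fN (b, t) hx1.
  suff -> : stage k (b, t) = floor_point x by [].
  rewrite -[RHS](downsK k) -/(h x) /stage; congr ups; apply: val_inj.
  rewrite val_outer_point ?depth_ge0 //=.
  rewrite [RHS]surjective_pairing; congr (_, _).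
  by rewrite /s /=; field; exact: lt0r_neq0.
have [femb fro] := open_injection_embedding fc finj fopen.
exists f; split=> // a t t0.
rewrite /f /stage t0 subr0 mulr1.
have := @ups_shift (m a) (outer_point a (total_shift (m a) (\val a))).
rewrite val_outer_point ?total_shift_ge0 //= subrr => -> //.
exact: set_mem (valP a).
Unshelve. all: end_near. Qed.
End Assembly.

(** * The boundary of a manifold is collared *)

(** The half-space of dimension 0 has no bounding hyperplane. *)
Lemma collared_set0 (R : realType) (X : topologicalType) (A : set X) :
  (forall x, ~ A x) -> collared R A.
Proof.
move=> noA; pose f (p : A * half_open_unit_interval R) : X := \val p.1.
have empty (p : A * half_open_unit_interval R) : False by exact: noA (set_mem (valP p.1)).
have [femb fo] : embedding f /\ open (range f).
  by apply: open_injection_embedding => p; case: (empty p).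
by exists f; split=> // a t; case: (empty (a, t)).
Qed.

Theorem theorem4p7 (R : realType) (n : nat) (X : topologicalType)
    (hX : manifold_with_boundary R n X) :
  collared R (manifold_boundary R n X).
Proof.
case: hX => hausX countX _; case: n => [|n].
  by apply: collared_set0 => x [U [phi [u [_ _ [[]]]]]].
have [mu [mub mu_pos]] := @bump_sequence R X (manifold_boundary R n.+1 X) countX
  (fun x => @bump_at R n X x hausX).
have [lam [lamc lam0 lam_mu lamP]] := locally_finite_bumps mub mu_pos.
have /choice[ud udP] : forall k, exists ud :
    (@outer_collar R X (manifold_boundary R n.+1 X) ->
    @outer_collar R X (manifold_boundary R n.+1 X)) * _, fibre_shift (lam k) ud.1 ud.2.
  move=> k; have [_ _ /(_ _ (lamc k) (lam0 k) (lam_mu k))[up [down ]]] := mub k.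
  by exists (up, down).
exact: (collared_of_fibre_shifts lamc lam0 udP lamP).
Qed.
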